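(* Let $E$ be a $[\lambda]$-primitive theme of rank $k$ with fundamental invariants $\lambda_1,\dots,\lambda_k$. For any rational number $\delta$ with $\delta>\lambda_k+k-1$, the (a,b)-module $E^*\otimes_{a,b}E_\delta$ is a $[\delta-\lambda]$-primitive theme with fundamental invariants $\delta-\lambda_k,\dots,\delta-\lambda_1$.
   Context: $\tilde{\mathcal A}$ is the $\mathbb C$-algebra of formal series $\sum_{\nu\ge0}P_\nu(a)b^\nu$ ($P_\nu\in\mathbb C[z]$) with product determined by $ab-ba=b^2$ and $b$-adic continuity of multiplication by $a$. An (a,b)-module is a left $\tilde{\mathcal A}$-module free of finite rank over $\mathbb C[[b]]$. Regular: contained in an (a,b)-module $E'$ with $aE'\subset bE'$; its Bernstein polynomial is the minimal polynomial of $-b^{-1}a$ on $E^\sharp/bE^\sharp$, $E^\sharp$ the saturation of $E$ by $b^{-1}a$ in $E[b^{-1}]$. $E_\mu=\mathbb C[[b]]e_\mu$ with $ae_\mu=\mu be_\mu$. A submodule $F\subset E$ is normal if $F\cap bE=bF$. Tensor product: $E\otimes_{a,b}F$ is $E\otimes_{\mathbb C[[b]]}F$ with $a(x\otimes y)=ax\otimes y+x\otimes ay$. Dual: $E^*=\mathrm{Hom}_{\mathbb C[[b]]}(E,E_0)$ with $(a\varphi)(x)=a(\varphi(x))-\varphi(ax)$, where $E_0=\mathbb C[[b]]e_0$, $ae_0=0$. For rational $\lambda\in]0,1]$, $\Xi_\lambda=\bigoplus_{j\ge0}\mathbb C[[b]]e_{\lambda,j}$ (finite sums; $e_{\lambda,j}$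 stands for $s^{\lambda-1}(\log s)^j/j!$), $ae_{\lambda,0}=\lambda be_{\lambda,0}$, $ae_{\lambda,j}=\lambda be_{\lambda,j}+be_{\lambda,j-1}$, extended by $aS(b)=S(b)a+b^2S'(b)$; $\Xi=\bigoplus_{\lambda\in\mathbb Q\cap]0,1]}\Xi_\lambda$. A theme is a left $\tilde{\mathcal A}$-module isomorphic to $\tilde{\mathcal A}\varphi\subset\Xi$, $\varphi\in\Xi$. A regular (a,b)-module is $[\lambda]$-primitive if every root of its Bernstein polynomial lies in $-\lambda+\mathbb Z$. A $[\lambda]$-primitive theme $E$ of rank $k$ has, for each $j\in[0,k]$, exactly one normal submodule $F_j$ of rank $j$, with $F_0\subset F_1\subset\dots\subset F_k=E$ and $F_j/F_{j-1}\cong E_{\lambda_j}$, $\lambda_j\in\lambda+\mathbb Z$ rational; the ordered sequence $\lambda_1,\dots,\lambda_k$ is called the fundamental invariants of $E$. *)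

(* Defs.v *)
From mathcomp Require Import all_boot all_algebra.
From mathcomp Require Import complex Rstruct.

Set Implicit Arguments.
Unset Strict Implicit.
Unset Printing Implicit Defensive.
Import GRing.Theory Num.Theory.
Local Open Scope ring_scope.

Definition C : Type := complex Rdefinitions.R.

(** Formal power series S(b) = sum_n S n b^n in C[[b]]. *)
Definition ps : Type := nat -> C.
Definition cst (c : C) : ps := fun n => if n == 0%N then c else 0.

(** ** (a,b)-modules, presented in a C[[b]]-basis e_1..e_k.
    An (a,b)-module free of rank k is determined by the matrix
    A(b) = sum_n b^n (amat n) of a on the basis:  a e_j = sum_i A(b)_{ij} e_i,
    and a(S(b) x) = S(b) a x + b^2 S'(b) x. *)
Record abmod := ABMod { rk : nat; amat : nat -> 'M[C]_rk }.

(** Elements of C[[b]]^k : x = sum_n b^n (x n). *)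
Definition vec (k : nat) : Type := nat -> 'cV[C]_k.

Definition vadd k (x y : vec k) : vec k := fun n => x n + y n.
Definition vzero k : vec k := fun _ => 0.
Definition vscal k (S : ps) (x : vec k) : vec k :=
  fun n => \sum_(i < n.+1) S i *: x (n - i)%N.
Definition vb k (x : vec k) : vec k :=
  fun n => if n is m.+1 then x m else 0.
Definition aact (E : abmod) (x : vec (rk E)) : vec (rk E) :=
  fun p => \sum_(i < p.+1) amat E i *m x (p - i)%N
           + (if p is q.+1 then q%:R *: x q else 0).
Arguments aact : clear implicits.

(** E_mu = C[[b]] e_mu with a e_mu = mu b e_mu. *)
Definition Emu (mu : C) : abmod :=
  @ABMod 1 (fun n => if n == 1%N then mu%:M else 0).

(** E^* ⊗_{a,b} E_delta, written in the basis (e_i^* ⊗ e_delta) built from the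
    dual basis: a e_i^* = - sum_j A_{ij} e_j^*, and a e_delta = delta b e_delta. *)
Definition dual_tensor (E : abmod) (delta : C) : abmod :=
  @ABMod (rk E) (fun n => - (amat E n)^T + (if n == 1%N then delta%:M else 0)).

Definition is_abmor (E F : abmod) (f : vec (rk E) -> vec (rk F)) : Prop :=
  [/\ forall x y, f (vadd x y) = vadd (f x) (f y),
      forall S x, f (vscal S x) = vscal S (f x)
    & forall x, f (aact E x) = aact F (f x)].
Arguments is_abmor : clear implicits.

Definition sub_rank (E : abmod) (P : vec (rk E) -> Prop) (j : nat) : Prop :=
  exists (M : nat -> 'M[C]_j) (f : vec j -> vec (rk E)),
    [/\ is_abmor (@ABMod j M) E f, injective f & forall y, P y <-> exists x, f x = y].
Arguments sub_rank : clear implicits.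

Definition normal (E : abmod) (P : vec (rk E) -> Prop) : Prop :=
  forall y, (P y /\ exists z, y = vb z) <-> (exists z, P z /\ y = vb z).
Arguments normal : clear implicits.

Definition quot_iso (E : abmod) (P Q : vec (rk E) -> Prop) (G : abmod) : Prop :=
  exists g : vec (rk E) -> vec (rk G),
    [/\ forall x y, P x -> P y -> g (vadd x y) = vadd (g x) (g y),
        forall S x, P x -> g (vscal S x) = vscal S (g x),
        forall x, P x -> g (aact E x) = aact G (g x),
        forall z, exists2 x, P x & g x = z
      & forall x, P x -> (g x = vzero (rk G) <-> Q x)].
Arguments quot_iso : clear implicits.

Definition regular (E : abmod) : Prop :=
  exists (E' : abmod) (f : vec (rk E) -> vec (rk E')),
    [/\ is_abmor E E' f, injective f & forall y, exists z, aact E' y = vb z].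

(** ** E[b^-1], the saturation E^# and the Bernstein polynomial.
    An element of E[b^-1] is represented by a pair (N, y) standing for b^-N y;
    its value is the Laurent sequence of its coefficients. *)
Definition lrep k : Type := (nat * vec k)%type.
Definition lval k (p : lrep k) : int -> 'cV[C]_k :=
  fun q => match (q + (p.1)%:Z)%R with Posz n => p.2 n | Negz _ => 0 end.
Definition ladd k (p q : lrep k) : lrep k :=
  ((p.1 + q.1)%N, vadd (iter q.1 (@vb k) p.2) (iter p.1 (@vb k) q.2)).
Definition lscal k (S : ps) (p : lrep k) : lrep k := (p.1, vscal S p.2).
Definition lb k (p : lrep k) : lrep k := (p.1, vb p.2).
(** b^-1 a (b^-N y) = b^-(N+1) (a y - N b y) *)
Definition lT (E : abmod) (p : lrep (rk E)) : lrep (rk E) :=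
  (p.1.+1, vadd (aact E p.2) (vscal (cst (- (p.1)%:R)) (vb p.2))).
Arguments lT : clear implicits.

Inductive sat (E : abmod) : (int -> 'cV[C]_(rk E)) -> Prop :=
  | sat_E y : @sat E (lval (0%N, y))
  | sat_add p q : @sat E (lval p) -> @sat E (lval q) -> @sat E (lval (ladd p q))
  | sat_scal S p : @sat E (lval p) -> @sat E (lval (lscal S p))
  | sat_T p : @sat E (lval p) -> @sat E (lval (lT E p)).
Arguments sat : clear implicits.

Definition lpoly (E : abmod) (Q : {poly C}) (p : lrep (rk E)) : lrep (rk E) :=
  foldr (fun i acc => ladd (lscal (cst Q`_i) (iter i (fun r => lscal (cst (-1)) (lT E r)) p)) acc)
        (0%N, vzero (rk E)) (iota 0 (size Q)).
Arguments lpoly : clear implicits.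

Definition kills (E : abmod) (Q : {poly C}) : Prop :=
  forall p, sat E (lval p) ->
    exists2 q, sat E (lval q) & lval (lpoly E Q p) = lval (lb q).

Definition bernstein (E : abmod) (B : {poly C}) : Prop :=
  [/\ B \is monic, kills E B & forall Q, kills E Q -> B %| Q].

Definition primitive (E : abmod) (lam : rat) : Prop :=
  regular E /\
  exists B, bernstein E B /\
    forall z, root B z -> exists m : int, z = ratr (- lam) + m%:~R.

(** ** Xi and themes.  An element of Xi is x = sum_{lam,j,n} x lam j n b^n e_{lam,j}. *)
Definition xi : Type := rat -> nat -> nat -> C.
Definition in_Xi (x : xi) : Prop :=
  exists (L : seq rat) (J : nat), forall l j n, x l j n != 0 ->
    [/\ 0 < l <= 1, l \in L & (j < J)%N].
Definition xadd (x y : xi) : xi := fun l j n => x l j n + y l j n.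
Definition xscal (S : ps) (x : xi) : xi :=
  fun l j n => \sum_(i < n.+1) S i * x l j (n - i)%N.
Definition xb (x : xi) : xi := fun l j n => if n is m.+1 then x l j m else 0.
(** a e_{l,j} = l b e_{l,j} + b e_{l,j-1},  a S = S a + b^2 S' *)
Definition xa (x : xi) : xi :=
  fun l j n => if n is m.+1 then (ratr l + m%:R) * x l j m + x l j.+1 m else 0.
Definition xpoly (P : {poly C}) (x : xi) : xi :=
  fun l j n => \sum_(i < size P) P`_i * iter i xa x l j n.

(** Ã phi = { sum_nu P_nu(a) b^nu phi } (the series converges coefficientwise) *)
Definition Agen (phi psi : xi) : Prop :=
  exists P : nat -> {poly C}, forall l j n,
    psi l j n = \sum_(v < n.+1) xpoly (P v) (iter v xb phi) l j n.

Definition is_theme (E : abmod) : Prop :=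
  exists phi : xi, in_Xi phi /\
  exists f : vec (rk E) -> xi,
    [/\ forall x y, f (vadd x y) = xadd (f x) (f y),
        forall S x, f (vscal S x) = xscal S (f x),
        forall x, f (aact E x) = xa (f x),
        injective f
      & forall psi, Agen phi psi <-> exists x, f x = psi].

(** ** Fundamental invariants: F_j is the unique normal submodule of rank j,
    and F_j / F_{j-1} ≅ E_{lambda_j}, with lambda_j = nth 0 ls (j-1). *)
Definition fund_inv (E : abmod) (ls : seq rat) : Prop :=
  size ls = rk E /\
  exists F : nat -> (vec (rk E) -> Prop),
    [/\ forall j, (j <= rk E)%N -> sub_rank E (F j) j /\ normal E (F j),
        forall j, (j < rk E)%N -> forall x, F j x -> F j.+1 x,
        forall x, F (rk E) x,
        forall j P, (j <= rk E)%N -> sub_rank E P j -> normal E P ->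
                    forall x, P x <-> F j x
      & forall j, (0 < j <= rk E)%N ->
          quot_iso E (F j) (F j.-1) (Emu (ratr (nth 0 ls j.-1)))].

(* Main.v *)
(** In a basis adapted to the flag of normal submodules, a theme of rank k is given
    by an upper triangular matrix with diagonal lambda_i b. Being generated by one
    element modulo b means that the superdiagonal entries S_i are units, and the
    uniqueness of the normal submodules means that p_i = lambda_{i+1} - lambda_i + 1
    is a natural number and that the coefficient of b^p_i in S_i does not vanish:
    this is the obstruction to diagonalising the rank two quotient F_{i+1}/F_{i-1}
    over C((b)). These conditions are self-dual up to reversal of the order, which
    sends lambda_i to delta - lambda_{k+1-i}. Conversely they give back all the
    properties: the equations (a - mu_j b) x_j = ... can be solved one after the other
    in Xi, the resonances raising the degree in log by exactly one at each step, as
    soon as mu_1 > k - 1 keeps all exponents of s above -1; a normal submodule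
    containing an element of F_i outside F_{i-1} contains F_i; and E lies in the
    lattice spanned by the b^{-(k-i)} e_i, which is stable by b^{-1}a with eigenvalues
    in lambda + Z. *)
From HB Require Import structures.
Require Import Defs.
From mathcomp Require Import all_boot all_order all_algebra.
From mathcomp Require Import complex Rstruct.
From mathcomp Require Import boolp zify ring lra.

Set Implicit Arguments.
Unset Strict Implicit.
Unset Printing Implicit Defensive.
Import GRing.Theory Num.Theory Order.TTheory.
Local Open Scope ring_scope.

(** * Formal power series *)

(** Being a theme means having a suitable map to Xi, and duality transports no such map; hence the
    detour through conditions on matrix entries, which survive the replacement of A by -A^T + delta
    b. The constant k - 1 counts lost powers of b. In Xi the action of a raises the b-degree by one,
    whereas multiplication by a unit S_i does not, so x_{i+1} may start one power of b below x_i. In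
    rank k this can happen k - 1 times, and the room has to be present in the first exponent of the
    dual, delta - lambda_k. The same loss gives b^{-1}a a pole on E, and the weights of the lattice
    change by one per step of the flag to absorb it. The Bernstein polynomial of the dual is not
    computed: it divides a product of linear factors whose roots are explicit. Conversely, only one
    root of the Bernstein polynomial of E is identified, on the first line of the flag; integrality
    of the p_i then gives the class modulo Z of all the invariants. *)

Definition psr (K : numFieldType) : Type := nat -> K.

(* The operations are locked: unification must not unfold them down to K. *)
HB.lock Definition ps_zero (K : numFieldType) : psr K := fun _ => 0.
HB.lock Definition ps_opp (K : numFieldType) (S : psr K) : psr K := fun n => - S n.
HB.lock Definition ps_add (K : numFieldType) (S T : psr K) : psr K := fun n => S n + T n.
HB.lock Definition ps_mul (K : numFieldType) (S T : psr K) : psr K :=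
  fun n => \sum_(i < n.+1) S i * T (n - i)%N.
HB.lock Definition ps_cst (K : numFieldType) (c : K) : psr K :=
  fun n => if n == 0%N then c else 0.
HB.lock Definition bb {K : numFieldType} : psr K := fun n => (n == 1%N)%:R.
(* Euler derivation b d/db, so that [b * ps_d] is the b^2 d/db of the definition of a. *)
HB.lock Definition ps_d (K : numFieldType) (S : psr K) : psr K := fun n => n%:R * S n.

Section PowerSeries.
Variable K : numFieldType.
Implicit Types S T U : psr K.

Local Notation ps_zero := (ps_zero K).
Local Notation ps_opp := (@ps_opp K).
Local Notation ps_add := (@ps_add K).
Local Notation ps_mul := (@ps_mul K).
Local Notation ps_cst := (@ps_cst K).
Local Notation ps_d := (@ps_d K).
Local Notation bb := (@bb K).
HB.instance Definition _ := gen_eqMixin (psr K).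
HB.instance Definition _ := gen_choiceMixin (psr K).


Fact ps_addA : associative ps_add.
Proof. by move=> S T U; apply: funext => n; rewrite ps_add.unlock; apply: addrA. Qed.
Fact ps_addC : commutative ps_add.
Proof. by move=> S T; apply: funext => n; rewrite ps_add.unlock; apply: addrC. Qed.
Fact ps_add0 : left_id ps_zero ps_add.
Proof. by move=> S; apply: funext => n; rewrite ps_add.unlock ps_zero.unlock; apply: add0r. Qed.
Fact ps_addN : left_inverse ps_zero ps_opp ps_add.
Proof. by move=> S; apply: funext => n; rewrite ps_add.unlock ps_zero.unlock ps_opp.unlock; apply: addNr. Qed.

HB.instance Definition _ :=
  GRing.isZmodule.Build (psr K) ps_addA ps_addC ps_add0 ps_addN.

Let ps_mulE S T n : ps_mul S T n = \sum_(i < n.+1) S i * T (n - i)%N.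
Proof. by rewrite ps_mul.unlock. Qed.

Let trunc N S : {poly K} := \poly_(i < N) S i.

(** Low coefficients of a product only see truncations, so commutativity and associativity are
    inherited from polynomials. *)
Lemma ps_mul_trunc N S T n :
  (n < N)%N -> ps_mul S T n = (trunc N S * trunc N T)`_n.
Proof.
move=> nN; rewrite ps_mul.unlock coefM; apply: eq_bigr => i _; rewrite !coef_poly.
by rewrite (leq_trans (ltn_ord i) nN) (leq_ltn_trans (leq_subr _ _) nN).
Qed.

Fact ps_mulC : commutative ps_mul.
Proof.
by move=> S T; apply: funext => n; rewrite !(@ps_mul_trunc n.+1) // mulrC.
Qed.
Fact ps_mulA : associative ps_mul.
Proof.
move=> S T U; apply: funext => n.
transitivity ((trunc n.+1 S * (trunc n.+1 T * trunc n.+1 U))`_n).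
  rewrite ps_mulE coefM; apply: eq_bigr => i _; rewrite coef_poly ltn_ord.
  by rewrite (@ps_mul_trunc n.+1) // ltnS leq_subr.
rewrite mulrA ps_mulE coefM; apply: eq_bigr => i _.
by rewrite coef_poly ltnS leq_subr (@ps_mul_trunc n.+1).
Qed.
Fact ps_mul1 : left_id (ps_cst 1) ps_mul.
Proof.
move=> S; apply: funext => n; rewrite ps_mulE ps_cst.unlock big_ord_recl subn0 mul1r.
by rewrite big1 ?addr0 // => i _; rewrite mul0r.
Qed.
Fact ps_mulDl : left_distributive ps_mul ps_add.
Proof.
move=> S T U; apply: funext => n; rewrite ps_add.unlock !ps_mulE -big_split.
by apply: eq_bigr => i _; apply: mulrDl.
Qed.
Lemma ps0E n : (0 : psr K) n = 0.
Proof. by change (ps_zero n = 0); rewrite ps_zero.unlock. Qed.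

Fact ps_one_neq0 : ps_cst 1 != 0 :> psr K.
Proof.
apply/eqP => /(congr1 (fun S : psr K => S 0%N)) /= /eqP.
by rewrite ps0E ps_cst.unlock oner_eq0.
Qed.

HB.instance Definition _ := GRing.Zmodule_isComNzRing.Build (psr K)
  ps_mulA ps_mulC ps_mul1 ps_mulDl ps_one_neq0.

Lemma psDE S T n : (S + T) n = S n + T n.
Proof. by change (ps_add S T n = S n + T n); rewrite ps_add.unlock. Qed.
Lemma psNE S n : (- S) n = - S n.
Proof. by change (ps_opp S n = - S n); rewrite ps_opp.unlock. Qed.
Lemma psBE S T n : (S - T) n = S n - T n. Proof. by rewrite psDE psNE. Qed.
Lemma psME S T n : (S * T) n = \sum_(i < n.+1) S i * T (n - i)%N.
Proof. exact: ps_mulE. Qed.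
Lemma ps1E n : (1 : psr K) n = (n == 0%N)%:R.
Proof. by change (ps_cst 1 n = (n == 0%N)%:R); rewrite ps_cst.unlock; case: eqP. Qed.
Lemma ps_sumE (I : Type) (r : seq I) (P : pred I) (F : I -> psr K) n :
  (\sum_(i <- r | P i) F i) n = \sum_(i <- r | P i) F i n.
Proof. exact: (big_morph (fun S : psr K => S n) (fun S T => psDE S T n) (ps0E n)). Qed.
Lemma psM0 S T : (S * T) 0%N = S 0%N * T 0%N.
Proof. by rewrite psME big_ord1. Qed.

Lemma ps_cstE c n : ps_cst c n = if n == 0%N then c else 0. Proof. by rewrite ps_cst.unlock. Qed.
Lemma ps_cstM c S n : (ps_cst c * S) n = c * S n.
Proof.
rewrite psME big_ord_recl subn0 ps_cstE big1 ?addr0 // => i _.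
by rewrite ps_cstE mul0r.
Qed.
Fact ps_cst_additive : zmod_morphism ps_cst.
Proof.
by move=> c e; apply: funext => n; rewrite psBE !ps_cstE; case: eqP; rewrite ?subr0.
Qed.
Fact ps_cst_multiplicative : GRing.monoid_morphism ps_cst.
Proof.
split=> // c e; apply: funext => n; rewrite ps_cstM !ps_cstE.
by case: eqP => // _; rewrite mulr0.
Qed.
HB.instance Definition _ := GRing.isZmodMorphism.Build K (psr K) ps_cst ps_cst_additive.
HB.instance Definition _ := GRing.isMonoidMorphism.Build K (psr K) ps_cst ps_cst_multiplicative.

Lemma bbM0 S : (bb * S) 0%N = 0. Proof. by rewrite psM0 bb.unlock mul0r. Qed.
Lemma bbMS S n : (bb * S) n.+1 = S n.
Proof.
rewrite psME bb.unlock big_ord_recl mul0r add0r big_ord_recl /= subSS subn0 mul1r.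
by rewrite big1 ?addr0 // => i _; rewrite mul0r.
Qed.
Lemma bbXM m S n : (bb ^+ m * S) n = if (m <= n)%N then S (n - m)%N else 0.
Proof.
elim: m n => [|m IH] n; first by rewrite mul1r subn0.
by rewrite exprS -mulrA; case: n => [|n]; rewrite ?bbM0 // bbMS IH.
Qed.
Lemma bb_inj : injective ( *%R bb).
Proof. by move=> S T E; apply: funext => n; rewrite -bbMS E bbMS. Qed.
Lemma bbX_inj m : injective ( *%R (bb ^+ m)).
Proof.
move=> S T E; apply: funext => n; have := congr1 (fun U : psr K => U (n + m)%N) E.
by rewrite !bbXM leq_addl addnK.
Qed.
Lemma ps_divb S : S 0%N = 0 -> exists T, S = bb * T.
Proof.
move=> S0; exists (fun n => S n.+1); apply: funext => -[|n].
  by rewrite bbM0.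
by rewrite bbMS.
Qed.

Fact ps_d_additive : zmod_morphism ps_d.
Proof. by move=> S T; apply: funext => n; rewrite ps_d.unlock psBE !psBE mulrBr. Qed.
HB.instance Definition _ := GRing.isZmodMorphism.Build (psr K) (psr K) ps_d ps_d_additive.
Lemma ps_dE S n : ps_d S n = n%:R * S n. Proof. by rewrite ps_d.unlock. Qed.
Lemma ps_dM S T : ps_d (S * T) = ps_d S * T + S * ps_d T.
Proof.
apply: funext => n; rewrite ps_dE psDE !psME mulr_sumr -big_split.
apply: eq_bigr => i _; rewrite /= !ps_dE (mulrA (S i)) (mulrC (S i) (_%:R)).
by rewrite -!mulrA -mulrDl -natrD subnKC // -ltnS.
Qed.
Lemma ps_d_cst c : ps_d (ps_cst c) = 0.
Proof. by apply: funext => -[|n]; rewrite ps_dE ps_cstE ps0E /= ?mul0r ?mulr0. Qed.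
Lemma ps_d1 : ps_d 1 = 0. Proof. exact: ps_d_cst. Qed.
Lemma ps_d_bbX m : ps_d (bb ^+ m) = m%:R * bb ^+ m.
Proof.
apply: funext => n; rewrite ps_dE -[bb ^+ m]mulr1.
have -> : m%:R = ps_cst m%:R by rewrite rmorph_nat.
rewrite ps_cstM bbXM ps1E; case: leqP => [mn|]; last by rewrite !mulr0.
by rewrite subn_eq0; case: leqP => nm; rewrite ?mulr0 // (@anti_leq n m) // nm mn.
Qed.
Lemma ps_d_bb : ps_d bb = bb.
Proof. by have := ps_d_bbX 1; rewrite expr1 mul1r. Qed.

(** Geometric series: up to a constant S is 1 - bX, and (bX)^i starts in degree i, so coefficient n
    of the inverse is read off the partial sum of order n. *)
Lemma ps_inv S : S 0%N != 0 -> exists T, S * T = 1.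
Proof.
move=> S0; pose c := ps_cst (S 0%N)^-1.
have [X XE] : exists X, 1 - c * S = bb * X.
  by apply: ps_divb; rewrite psBE ps1E eqxx ps_cstM mulVf // subrr.
pose T : psr K := fun n => (\sum_(i < n.+1) (bb * X) ^+ i) n.
have Xlow i n : (n < i)%N -> ((bb * X) ^+ i) n = 0.
  by move=> ni; rewrite exprMn bbXM leqNgt ni.
have TE N n : (n <= N)%N -> T n = (\sum_(i < N.+1) (bb * X) ^+ i) n.
  move=> nN; rewrite /T !ps_sumE (@big_ord_widen _ _ _ n.+1 N.+1 (fun i => ((bb * X) ^+ i) n) nN).
  rewrite big_mkcond; apply: eq_bigr => i _.
  by rewrite ltnS; case: leqP => // /Xlow ->.
exists (c * T); rewrite mulrA [S * c]mulrC.
have -> : c * S = 1 - bb * X by rewrite -XE opprB addrC subrK.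
apply: funext => n.
have -> : ((1 - bb * X) * T) n = ((1 - bb * X) * \sum_(i < n.+1) (bb * X) ^+ i) n.
  by rewrite !psME; apply: eq_bigr => i _; rewrite -TE // leq_subr.
by rewrite -opprB mulNr -subrX1 opprB psBE Xlow // subr0.
Qed.

Lemma ps_unit_part S : S != 0 ->
  exists m U V, [/\ S = bb ^+ m * U, U * V = 1 & U 0%N != 0].
Proof.
move=> S0; have [n Sn] : exists n, S n != 0.
  apply: contrapT => /forallNP H; case/negP: S0; apply/eqP/funext => n.
  by have /negP := H n; rewrite negbK => /eqP ->; rewrite ps0E.
have ex : exists n, (fun n => S n != 0) n by exists n.
case: (ex_minnP ex) => m /= Sm mmin.
pose U : psr K := fun i => S (i + m)%N.
have [V UV] : exists V, U * V = 1 by apply: ps_inv.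
exists m, U, V; split=> //; apply: funext => i; rewrite bbXM.
case: leqP => [mi|im]; first by rewrite /U subnK.
by case: (eqVneq (S i) 0) => // /mmin; rewrite leqNgt im.
Qed.

End PowerSeries.

(** * The action of a on C[[b]]^k *)

(** This is P(T) v. The operators T of interest are K-linear but do not commute with b, so the
    coefficients of P act as constant series. *)
HB.lock Definition polop (K : numFieldType) (V : lmodType (psr K)) (T : V -> V)
  (P : {poly K}) (v : V) : V := \sum_(i < size P) ps_cst P`_i *: iter i T v.
HB.lock Definition act (K : numFieldType) (k : nat) (M : 'M[psr K]_k) (u : 'cV[psr K]_k) :
  'cV[psr K]_k := M *m u + bb *: map_mx (@ps_d K) u.

Section PolynomialOperators.
Variables (K : numFieldType) (V : lmodType (psr K)) (T : {additive V -> V}).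
Hypothesis TZ : forall c v, T (ps_cst c *: v) = ps_cst c *: T v.
Implicit Types P Q : {poly K}.

Local Notation polop := (polop T).
Lemma polopE n P v : (size P <= n)%N ->
  polop P v = \sum_(i < n) ps_cst P`_i *: iter i T v.
Proof.
move=> sPn; rewrite polop.unlock (big_ord_widen n (fun i => ps_cst P`_i *: iter i T v) sPn).
rewrite big_mkcond; apply: eq_bigr => i _; case: ltnP => // sPi.
by rewrite nth_default // rmorph0 scale0r.
Qed.

Lemma iterTD i : {morph iter i T : x y / x + y}.
Proof. by elim: i => // i IH x y; rewrite !iterS IH raddfD. Qed.

Lemma iterT0 i : iter i T 0 = 0.
Proof. by elim: i => // i IH; rewrite iterS IH raddf0. Qed.

Lemma iterTZ i c v : iter i T (ps_cst c *: v) = ps_cst c *: iter i T v.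
Proof. by elim: i => // i IH; rewrite !iterS IH TZ. Qed.

Lemma polopDl P Q v : polop (P + Q) v = polop P v + polop Q v.
Proof.
rewrite (polopE _ (leq_trans (size_polyD P Q) (leqnn _))).
rewrite (polopE _ (leq_maxl (size P) (size Q))) (polopE _ (leq_maxr (size P) (size Q))).
by rewrite -big_split; apply: eq_bigr => i _; rewrite coefD rmorphD scalerDl.
Qed.

Lemma polopZl c P v : polop (c *: P) v = ps_cst c *: polop P v.
Proof.
rewrite (polopE _ (size_scale_leq c P)) polop.unlock scaler_sumr.
by apply: eq_bigr => i _; rewrite coefZ rmorphM scalerA.
Qed.

Lemma polopC c v : polop c%:P v = ps_cst c *: v.
Proof. by rewrite (polopE _ (size_polyC_leq1 c)) big_ord1 coefC. Qed.

Lemma polopMX P v : polop (P * 'X) v = polop P (T v).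
Proof.
have sPX : (size (P * 'X)%R <= (size P).+1)%N.
  by apply: leq_trans (size_polyMleq _ _) _; rewrite size_polyX addn2.
rewrite (polopE _ sPX) big_ord_recl coefMX /= rmorph0 scale0r add0r.
by rewrite polop.unlock; apply: eq_bigr => i _; rewrite coefMX /= -iterS iterSr.
Qed.

Lemma polop_cons P c v : polop (P * 'X + c%:P) v = polop P (T v) + ps_cst c *: v.
Proof. by rewrite polopDl polopMX polopC. Qed.

Lemma polopDr P v w : polop P (v + w) = polop P v + polop P w.
Proof.
rewrite polop.unlock -big_split; apply: eq_bigr => i _ /=.
by rewrite iterTD scalerDr.
Qed.

Lemma polop0 P : polop P 0 = 0.
Proof. by rewrite polop.unlock big1 // => i _; rewrite iterT0 scaler0. Qed.

Lemma polopZr P c v : polop P (ps_cst c *: v) = ps_cst c *: polop P v.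
Proof.
rewrite polop.unlock scaler_sumr; apply: eq_bigr => i _.
by rewrite iterTZ !scalerA mulrC.
Qed.

Lemma polopM P Q v : polop (P * Q) v = polop P (polop Q v).
Proof.
elim/poly_ind: Q v => [|Q c IH] v.
  by rewrite mulr0 (@polopE 0 0) ?size_poly0 // !big_ord0 polop0.
rewrite mulrDr polopDl mulrA polopMX IH polopDl polopMX polopDr.
by rewrite mulrC mul_polyC polopZl polopC polopZr.
Qed.

Lemma polopXn n v : polop 'X^n v = iter n T v.
Proof.
elim: n v => [|n IH] v; first by rewrite expr0 -polyC1 polopC rmorph1 scale1r.
by rewrite exprSr polopMX IH iterSr.
Qed.

End PolynomialOperators.

Section Action.
Variables (K : numFieldType) (k : nat).
Local Notation R := (psr K).
Implicit Types (M : 'M[R]_k) (u v : 'cV[R]_k).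

Fact act_additive M : zmod_morphism (act M).
Proof. by move=> u v; rewrite act.unlock mulmxBr map_mxB scalerBr opprD addrACA. Qed.
HB.instance Definition _ M := GRing.isZmodMorphism.Build 'cV[R]_k 'cV[R]_k (act M) (act_additive M).

Lemma actE M u i : (act M u) i 0 = \sum_j M i j * u j 0 + bb * ps_d (u i 0).
Proof. by rewrite act.unlock !mxE. Qed.

Lemma actZ M S u : act M (S *: u) = S *: act M u + (bb * ps_d S) *: u.
Proof.
rewrite act.unlock -scalemxAr scalerDr -addrA; congr (_ + _).
apply/matrixP => i j; rewrite !mxE ps_dM; ring.
Qed.

Lemma act_cst M c u : act M (ps_cst c *: u) = ps_cst c *: act M u.
Proof. by rewrite actZ ps_d_cst mulr0 scale0r addr0. Qed.

Lemma apop_cons M P c u :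
  polop (act M) (P * 'X + c%:P) u = polop (act M) P (act M u) + ps_cst c *: u.
Proof. exact: polop_cons. Qed.

(** [cf 0] is reduction modulo b. *)
Definition cf n u : 'cV[K]_k := map_mx (fun S : R => S n) u.
Lemma cfE n u i : cf n u i 0 = u i 0 n. Proof. by rewrite mxE. Qed.
Fact cf_additive n : zmod_morphism (cf n).
Proof. by move=> u v; apply/matrixP => i j; rewrite !mxE psBE. Qed.
HB.instance Definition _ n := GRing.isZmodMorphism.Build 'cV[R]_k 'cV[K]_k (cf n) (cf_additive n).

Lemma cfD n u v : cf n (u + v) = cf n u + cf n v. Proof. exact: raddfD. Qed.
Lemma cfB n u v : cf n (u - v) = cf n u - cf n v. Proof. exact: raddfB. Qed.
Lemma cf0E n : cf n (0 : 'cV[R]_k) = 0. Proof. exact: raddf0. Qed.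
Lemma cf_sum n (I : Type) (r : seq I) (P : pred I) (F : I -> 'cV[R]_k) :
  cf n (\sum_(i <- r | P i) F i) = \sum_(i <- r | P i) cf n (F i).
Proof. exact: raddf_sum. Qed.

Lemma cfP u v : (forall n, cf n u = cf n v) -> u = v.
Proof.
move=> E; apply/matrixP => i j; rewrite ord1; apply: funext => n.
by rewrite -!cfE E.
Qed.

Lemma cfZ n c u : cf n (ps_cst c *: u) = c *: cf n u.
Proof. by apply/matrixP => i j; rewrite !mxE ps_cstM. Qed.

Lemma cf_bbX n m u :
  cf n (bb ^+ m *: u) = if (m <= n)%N then cf (n - m) u else 0.
Proof. by apply/matrixP => i j; rewrite !mxE bbXM; case: ifP; rewrite ?mxE. Qed.

Lemma cf0_bb u : cf 0 (bb *: u) = 0.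
Proof. by apply/matrixP => i j; rewrite !mxE bbM0. Qed.

Lemma cf0_act M u : cf 0 (act M u) = map_mx (fun S : R => S 0%N) M *m cf 0 u.
Proof.
apply/matrixP => i j; rewrite act.unlock !mxE psDE bbM0 addr0 ps_sumE.
by apply: eq_bigr => l _; rewrite psM0 !mxE.
Qed.

Lemma bbX_divides n u : (forall m, (m < n)%N -> cf m u = 0) ->
  exists v, u = bb ^+ n *: v.
Proof.
move=> u0; exists (\col_i (fun m => u i 0 (m + n)%N)).
apply: cfP => m; rewrite cf_bbX; case: leqP => [nm|/u0 //].
by apply/matrixP => i j; rewrite !mxE ord1 subnK.
Qed.

Lemma act_bbX M n u : exists2 v, act M (bb ^+ n *: u) = bb ^+ n *: v
  & cf 0 v = cf 0 (act M u).
Proof.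
exists (act M u + bb *: (n%:R *: u)).
  rewrite actZ ps_d_bbX [RHS]scalerDr !scalerA; congr (_ + _); congr (_ *: _); ring.
by rewrite cfD cf0_bb addr0.
Qed.

Lemma cf0_polop M P u v : cf 0 u = cf 0 v ->
  cf 0 (polop (act M) P u) = cf 0 (polop (act M) P v).
Proof.
elim/poly_ind: P u v => [|P c IH] u v uv.
  by rewrite !(@polopE _ _ _ 0 0) ?size_poly0 // !big_ord0.
rewrite 2!apop_cons 2!cfD !cfZ uv; congr (_ + _).
by apply: IH; rewrite !cf0_act uv.
Qed.

(** From a b^n = b^n (a + n b): P(a) b^n u is b^n P(a + n b) u, and n b disappears modulo b. Hence a
    acts alike on all the quotients b^n E / b^(n+1) E. *)
Lemma polop_bbX M P n u : exists2 v, polop (act M) P (bb ^+ n *: u) = bb ^+ n *: v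
  & cf 0 v = cf 0 (polop (act M) P u).
Proof.
elim/poly_ind: P u => [|P c IH] u.
  by exists 0; rewrite !(@polopE _ _ _ 0 0) ?size_poly0 // !big_ord0 ?scaler0.
have [v Ev v0] := act_bbX M n u; have [w Ew w0] := IH v.
exists (w + ps_cst c *: u).
  rewrite apop_cons Ev Ew [RHS]scalerDr !scalerA; congr (_ + _).
  by rewrite mulrC.
rewrite apop_cons 2!cfD w0; congr (_ + _).
exact: cf0_polop.
Qed.

(** The element sum_v P_v(a) b^v u of the cyclic module generated by u. The term of index v is
    divisible by b^v, so a finite sum determines each coefficient. *)
Definition op_series M (P : nat -> {poly K}) u : 'cV[R]_k :=
  \col_i (fun n => (\sum_(v < n.+1) polop (act M) (P v) (bb ^+ v *: u)) i 0 n).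

Lemma cf_polop_bbX M P n m u : (m < n)%N ->
  cf m (polop (act M) P (bb ^+ n *: u)) = 0.
Proof.
by move=> mn; have [v -> _] := polop_bbX M P n u; rewrite cf_bbX leqNgt mn.
Qed.

Lemma cf_op_series M P u n N : (n <= N)%N ->
  cf n (op_series M P u) = cf n (\sum_(v < N.+1) polop (act M) (P v) (bb ^+ v *: u)).
Proof.
move=> nN; rewrite cf_sum; apply/matrixP => i j; rewrite ord1 !mxE -cfE.
rewrite cf_sum !summxE.
have nN' : (n < N.+1)%N by [].
rewrite (@big_ord_widen _ _ _ n.+1 N.+1
  (fun v : nat => cf n (polop (act M) (P v) (bb ^+ v *: u)) i 0) nN').
rewrite big_mkcond; apply: eq_bigr => v _; rewrite ltnS; case: leqP => // nv.
by rewrite cf_polop_bbX // mxE.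
Qed.

Lemma cf0_op_series M P u : cf 0 (op_series M P u) = cf 0 (polop (act M) (P 0%N) u).
Proof. by rewrite (@cf_op_series _ _ _ _ 0) // big_ord1 expr0 scale1r. Qed.

Definition cyclic_mod_b M u := forall w, exists Q, cf 0 (polop (act M) Q u) = w.

(** Successive approximation, as in Nakayama's lemma: the remainder [r v] is divisible by b^v, and a
    polynomial found modulo b removes its leading coefficient. *)
Lemma op_series_surj M u x : cyclic_mod_b M u -> exists P, op_series M P u = x.
Proof.
move=> /choice[pk pkE].
pose step (v : nat) (r : 'cV[R]_k) := r - polop (act M) (pk (cf v r)) (bb ^+ v *: u).
pose r := fix r (v : nat) := if v is v'.+1 then step v' (r v') else x.
have rlow (v n : nat) : (n < v)%N -> cf n (r v) = 0.
  elim: v n => // v IH n; rewrite ltnS leq_eqVlt => /orP[/eqP->|nv].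
    have [y Ey y0] := polop_bbX M (pk (cf v (r v))) v u.
    by rewrite /= /step cfB Ey cf_bbX leqnn subnn y0 pkE subrr.
  by rewrite /= /step cfB IH // cf_polop_bbX // subrr.
exists (fun v : nat => pk (cf v (r v))).
have rE n : r n = x - \sum_(v < n) polop (act M) (pk (cf v (r v))) (bb ^+ v *: u).
  elim: n => [|n IH]; first by rewrite big_ord0 subr0.
  by rewrite big_ord_recr /= opprD addrA -IH.
apply: cfP => n; rewrite (@cf_op_series _ _ _ _ n) //.
have := rlow n.+1 n (leqnn _); rewrite rE cfB => /eqP.
by rewrite subr_eq0 => /eqP ->.
Qed.

End Action.

(** * Cyclic vectors of matrices that are strictly triangular modulo b *)

Section CyclicTriangular.
Variables (K : numFieldType) (k : nat).
Local Notation R := (psr K).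
Variable M : 'M[R]_k.
Hypothesis Mlow : forall i j : 'I_k, (j <= i)%N -> M i j 0%N = 0.

Let cfact (u : 'cV[R]_k) (i : 'I_k) :
  cf 0 (act M u) i 0 = \sum_(j < k | (i < j)%N) M i j 0%N * cf 0 u j 0.
Proof.
rewrite cf0_act mxE [RHS]big_mkcond; apply: eq_bigr => j _.
by rewrite mxE; case: ltnP => // /Mlow ->; rewrite mul0r.
Qed.

Lemma iter_act_low u m (i : 'I_k) : (k <= i + m)%N -> cf 0 (iter m (act M) u) i 0 = 0.
Proof.
elim: m i => [|m IH] i kim; first by have := ltn_ord i; lia.
by rewrite iterS cfact big1 // => j ij; rewrite IH ?mulr0 //; lia.
Qed.

(** For u the last basis vector, the lowest nonzero coordinate of a^m u modulo b is the one of index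
    k - 1 - m, with a product of superdiagonal entries as value. Any vector is then reached by
    elimination from the bottom. *)
Lemma superdiag_cyclic :
  (forall i j : 'I_k, j = i.+1 :> nat -> M i j 0%N != 0) ->
  exists u, cyclic_mod_b M u.
Proof.
move=> Msup; pose u : 'cV[R]_k := \col_i (i.+1 == k)%:R; exists u.
have lead m (i : 'I_k) : (i + m).+1 = k -> cf 0 (iter m (act M) u) i 0 != 0.
  elim: m i => [|m IH] i kim.
    have ik : (i.+1 == k) = true by apply/eqP; lia.
    by rewrite !mxE ik mulr1n ps1E oner_neq0.
  have i1k : (i.+1 < k)%N by lia.
  rewrite iterS cfact (bigD1 (Ordinal i1k)) //= big1 ?addr0.
    by rewrite mulf_neq0 ?Msup // IH //=; lia.
  move=> j /andP[ij /negP ji]; rewrite iter_act_low ?mulr0 //.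
  suff: i.+1 != j by lia.
  by apply/negP => /eqP E; apply: ji; apply/eqP/val_inj.
suff H d (w : 'cV[K]_k) : (d <= k)%N -> (forall i : 'I_k, (d <= i)%N -> w i 0 = 0) ->
    exists Q, cf 0 (polop (act M) Q u) = w.
  by move=> w; apply: (H k) => // i; have := ltn_ord i; lia.
elim: d w => [|d IH] w dk wd.
  exists 0; rewrite (@polopE _ _ _ 0 0) ?size_poly0 // big_ord0 cf0E.
  by apply/matrixP => i j; rewrite mxE ord1 wd.
pose e := cf 0 (iter (k - d.+1) (act M) u).
pose c := w (Ordinal dk) 0 / e (Ordinal dk) 0.
have e0 : e (Ordinal dk) 0 != 0 by apply: lead => /=; lia.
have [||Q QE] := IH (w - c *: e); first exact: ltnW.
  move=> i; have -> : (w - c *: e) i 0 = w i 0 - c * e i 0 by rewrite !mxE.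
  rewrite leq_eqVlt => /orP[/eqP di|di].
    have -> : i = Ordinal dk by apply: val_inj.
    by rewrite divfK ?subrr.
  by rewrite wd // /e iter_act_low ?mulr0 ?subr0 //; lia.
exists (Q + c *: 'X^(k - d.+1)).
rewrite polopDl polopZl ?polopXn; try exact: act_cst.
by rewrite cfD QE cfZ subrK.
Qed.

(** If a superdiagonal entry vanished modulo b, the coordinates above it would die one step early
    and a^(k-1) would kill u modulo b. Then k - 1 vectors, the columns of [W], would span a space of
    dimension k. *)
Lemma cyclic_superdiag u : cyclic_mod_b M u ->
  forall i j : 'I_k, j = i.+1 :> nat -> M i j 0%N != 0.
Proof.
move=> cyc i j ji; apply/negP => /eqP Mij.
have low m (l : 'I_k) : (k <= i + m.+1)%N -> (k <= l + m.+1)%N ->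
    cf 0 (iter m (act M) u) l 0 = 0.
  elim: m l => [|m IH] l kim klm; first by have := ltn_ord j; lia.
  rewrite iterS cfact big1 // => t lt.
  have [kim'|] := leqP k (i + m.+1); first by rewrite IH ?mulr0 //; lia.
  move=> kim'; have [E|] := eqVneq (t : nat) j.
    have -> : t = j by apply: val_inj.
    have -> : l = i by apply: val_inj => /=; lia.
    by rewrite Mij mul0r.
  by move=> tj; rewrite iter_act_low ?mulr0 //; lia.
have k0 : (0 < k)%N := leq_ltn_trans (leq0n _) (ltn_ord i).
have nil m : (k.-1 <= m)%N -> cf 0 (iter m (act M) u) = 0.
  move=> km; apply/matrixP => l t; rewrite ord1 [RHS]mxE.
  by rewrite low //; lia.
pose W : 'M[K]_(k, k.-1) := \matrix_(l, m) cf 0 (iter m (act M) u) l 0.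
have surj w : exists z : 'cV_(k.-1), W *m z = w.
  have [Q <-] := cyc w; exists (\col_m Q`_m).
  rewrite (polopE _ _ (leq_maxl (size Q) k.-1)) cf_sum.
  have kQ := leq_maxr (size Q) k.-1.
  rewrite -(subnKC kQ) big_split_ord /= [X in _ + X]big1 ?addr0.
    apply/matrixP => l t; rewrite ord1 !mxE summxE.
    by apply: eq_bigr => m _; rewrite cfZ !mxE mulrC.
  by move=> m _; rewrite cfZ nil ?scaler0 // leq_addr.
have [Z ZE] := choice (fun l : 'I_k => surj (col l 1%:M)).
have : W *m \matrix_(m, l) Z l m 0 = 1%:M.
  apply/matrixP => l t; have := congr1 (fun w : 'cV_k => w l 0) (ZE t).
  by rewrite /= !mxE => <-; apply: eq_bigr => m _; rewrite !mxE.
by move/mulmx1_min; have := ltn_ord j; lia.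
Qed.

End CyclicTriangular.

(** * Matrices of (a,b)-modules and of their duals *)

Local Notation R := (psr C).

Definition tomx k (x : vec k) : 'cV[R]_k := \col_i (fun n => x n i 0).
Definition ofmx k (u : 'cV[R]_k) : vec k := fun n => cf n u.
Definition Amx (E : abmod) : 'M[R]_(rk E) := \matrix_(i, j) (fun n => amat E n i j).
Definition ofAmx k (M : 'M[R]_k) (n : nat) : 'M[C]_k := map_mx (fun S : R => S n) M.

Lemma tomxK k : cancel (@tomx k) (@ofmx k).
Proof.
by move=> x; apply: funext => n; apply/matrixP => i j; rewrite ord1 !mxE.
Qed.
Lemma ofmxK k : cancel (@ofmx k) (@tomx k).
Proof.
by move=> u; apply/matrixP => i j; rewrite ord1 mxE; apply: funext => n; rewrite mxE.
Qed.
Lemma cf_tomx k n (x : vec k) : cf n (tomx x) = x n.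
Proof. by apply/matrixP => i j; rewrite ord1 !mxE. Qed.
Lemma tomxD k (x y : vec k) : tomx (vadd x y) = tomx x + tomx y.
Proof. by apply/matrixP => i j; rewrite !mxE; apply: funext => n; rewrite psDE mxE. Qed.
Lemma tomx0 k : tomx (vzero k) = 0.
Proof.
apply/matrixP => i j; rewrite mxE [RHS]mxE; apply: funext => n.
by rewrite ps0E /vzero mxE.
Qed.
Lemma tomxZ k (S : R) (x : vec k) : tomx (vscal S x) = S *: tomx x.
Proof.
apply/matrixP => i j; rewrite !mxE; apply: funext => n.
by rewrite summxE psME; apply: eq_bigr => l _; rewrite !mxE.
Qed.
Lemma tomx_b k (x : vec k) : tomx (vb x) = bb *: tomx x.
Proof.
by apply/matrixP => i j; rewrite !mxE; apply: funext => -[|n]; rewrite ?bbM0 ?bbMS ?mxE.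
Qed.
Lemma tomx_a (E : abmod) (x : vec (rk E)) : tomx (aact E x) = act (Amx E) (tomx x).
Proof.
apply/matrixP => i j; rewrite ord1 act.unlock !mxE; apply: funext => n.
rewrite psDE ps_sumE !mxE summxE; congr (_ + _); last first.
  by case: n => [|n]; rewrite ?bbM0 ?bbMS ?ps_dE !mxE.
under eq_bigr => l _ do rewrite mxE.
rewrite exchange_big; apply: eq_bigr => l _.
by rewrite psME; apply: eq_bigr => t _; rewrite !mxE.
Qed.
Lemma Amx_of k (M : 'M[R]_k) : Amx (ABMod (ofAmx M)) = M.
Proof. by apply/matrixP => i j; rewrite !mxE; apply: funext => n; rewrite mxE. Qed.

Definition dm m n (A : 'M[R]_(m, n)) : 'M[R]_(m, n) := map_mx (@ps_d C) A.
Lemma dmM m n p (A : 'M[R]_(m, n)) (B : 'M[R]_(n, p)) :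
  dm (A *m B) = dm A *m B + A *m dm B.
Proof.
apply/matrixP => i j; rewrite !mxE raddf_sum -big_split.
by apply: eq_bigr => l _; rewrite /= ps_dM !mxE.
Qed.
Lemma dmT m n (A : 'M[R]_(m, n)) : dm A^T = (dm A)^T.
Proof. by apply/matrixP => i j; rewrite !mxE. Qed.
Lemma dm1 n : dm (1%:M : 'M[R]_n) = 0.
Proof. by apply/matrixP => i j; rewrite !mxE; case: eqP; rewrite ?ps_d1 ?raddf0. Qed.

(** The term [bb *: dm W] is b^2 W'; it comes from a acting as a derivation on the entries of W. *)
Lemma act_mulmx m n (M : 'M[R]_m) (N : 'M[R]_n) (W : 'M[R]_(m, n)) u :
  M *m W + bb *: dm W = W *m N -> act M (W *m u) = W *m act N u.
Proof.
move=> H; rewrite act.unlock -/(dm _) dmM mulmxDr mulmxA scalerDr addrA.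
by rewrite scalemxAl -mulmxDl H mulmxA -scalemxAr.
Qed.

(* [kp] and [ki] are mutually inverse C[[b]]-coordinates on E in which a has matrix M. *)
Record coords (E : abmod) (M : 'M[R]_(rk E))
    (kp : vec (rk E) -> 'cV[R]_(rk E)) (ki : 'cV[R]_(rk E) -> vec (rk E)) : Prop := Coords {
  kpK : cancel kp ki;
  kiK : cancel ki kp;
  kpD : forall x y, kp (vadd x y) = kp x + kp y;
  kpZ : forall S x, kp (vscal S x) = (S : R) *: kp x;
  kpb : forall x, kp (vb x) = bb *: kp x;
  kpa : forall x, kp (aact E x) = act M (kp x) }.

(** The columns of [P] are the new basis, and [fA] is the gauge relation A P + b^2 P' = P M. *)
Record frame (E : abmod) (P Q M : 'M[R]_(rk E)) : Prop := Frame {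
  fPQ : P *m Q = 1%:M;
  fA : Amx E *m P + bb *: dm P = P *m M }.

Lemma frame_coords E P Q M : @frame E P Q M ->
  coords M (fun x => Q *m tomx x) (fun c => ofmx (P *m c)).
Proof.
move=> [PQ FA]; have QP := mulmx1C PQ; split.
- by move=> x; rewrite mulmxA PQ mul1mx tomxK.
- by move=> c; rewrite ofmxK mulmxA QP mul1mx.
- by move=> x y; rewrite tomxD mulmxDr.
- by move=> S x; rewrite tomxZ -scalemxAr.
- by move=> x; rewrite tomx_b -scalemxAr.
move=> x; rewrite tomx_a -{1}[tomx x]mul1mx -PQ -mulmxA (act_mulmx _ FA).
by rewrite mulmxA QP mul1mx.
Qed.

Lemma ki_ext E M kp ki (H : @coords E M kp ki) x y : kp x = kp y -> x = y.
Proof. exact: can_inj (kpK H) x y. Qed.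

(** Indexing by natural numbers lets leading blocks and the reversal of indices be written without
    casts of ordinals. *)
Definition natmx k (M : nat -> nat -> R) : 'M[R]_k := \matrix_(i, j) M i j.

Record theme_form (k : nat) (M : nat -> nat -> R) (mu : nat -> rat) : Prop := ThemeForm {
  g_low : forall i j, (j < i)%N -> (i < k)%N -> M i j = 0;
  g_diag : forall i, (i < k)%N -> M i i = ps_cst (ratr (mu i)) * bb;
  g_sup0 : forall i, (i.+1 < k)%N -> M i i.+1 0%N != 0;
  g_res : forall i, (i.+1 < k)%N ->
    exists p : nat, mu i.+1 + 1 = mu i + p%:R /\ M i i.+1 p != 0 }.

(** Dualising makes an upper triangular matrix lower triangular; reversing the basis restores the
    shape. *)
HB.lock Definition rmx k : 'M[psr C]_k := \matrix_(i, j) (j == rev_ord i)%:R.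
Lemma mul_rmx k n (X : 'M[R]_(k, n)) i j : (rmx k *m X) i j = X (rev_ord i) j.
Proof.
rewrite rmx.unlock mxE (bigD1 (rev_ord i)) //= mxE eqxx mul1r big1 ?addr0 // => l /negPf li.
by rewrite mxE li mul0r.
Qed.
Lemma mulmx_rmx k n (X : 'M[R]_(n, k)) i j : (X *m rmx k) i j = X i (rev_ord j).
Proof.
rewrite rmx.unlock mxE (bigD1 (rev_ord j)) //= mxE rev_ordK eqxx mulr1 big1 ?addr0 // => l lj.
rewrite mxE -(inj_eq rev_ord_inj) rev_ordK eq_sym (negPf lj).
by rewrite mulr0.
Qed.
Lemma rmxK k : rmx k *m rmx k = 1%:M.
Proof.
apply/matrixP => i j; by rewrite mul_rmx rmx.unlock !mxE rev_ordK eq_sym.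
Qed.
Lemma dm_rmx k : dm (rmx k) = 0.
Proof. by apply/matrixP => i j; rewrite rmx.unlock !mxE; case: eqP; rewrite ?ps_d1 ?raddf0. Qed.

Lemma Amx_dual E delta :
  Amx (dual_tensor E delta) = - (Amx E)^T + (ps_cst delta * bb)%:M.
Proof.
apply/matrixP => i j; rewrite !mxE; apply: funext => n.
rewrite psDE psNE !mxE; congr (_ + _).
have -> : (ps_cst delta * bb *+ (i == j)) = ps_cst (delta *+ (i == j)) * bb :> R.
  by case: eqP => _; rewrite ?mulr1n // !mulr0n rmorph0 mul0r.
rewrite ps_cstM bb.unlock; case: eqP => _; rewrite !mxE ?mulr1 ?mulr0 //.
Qed.

Definition dualM k (delta : rat) (M : nat -> nat -> R) : nat -> nat -> R :=
  fun i j => - M (k.-1 - j)%N (k.-1 - i)%N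
             + (if i == j then ps_cst (ratr delta) * bb else 0).

Section DualBasis.
Variables (k : nat) (A P Q M : 'M[R]_k) (c : R).
Hypotheses (PQ : P *m Q = 1%:M) (FA : A *m P + bb *: dm P = P *m M).

Local Notation r := (rmx k).
Let rr (n : nat) (X : 'M[R]_(n, k)) : X *m r *m r = X.
Proof. by rewrite -[LHS]mulmxA rmxK mulmx1. Qed.

Lemma dual_basisK : (Q^T *m r) *m (r *m P^T) = 1%:M.
Proof. by rewrite mulmxA rr -trmx_mul PQ trmx1. Qed.

Let dQ : bb *: dm Q = Q *m A - M *m Q.
Proof.
have QP := mulmx1C PQ.
have AE : A = P *m M *m Q - bb *: (dm P *m Q).
  by rewrite -FA mulmxDl -scalemxAl addrK -mulmxA PQ mulmx1.
have dE : Q *m dm P *m Q = - dm Q.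
  have /eqP := congr1 (@dm _ _) QP; rewrite dm1 dmM addrC addr_eq0 => /eqP ->.
  by rewrite mulNmx -mulmxA PQ mulmx1.
rewrite {1}AE mulmxBr !mulmxA QP mul1mx addrAC subrr add0r -scalemxAr mulmxA dE.
by rewrite scalerN opprK.
Qed.

(** Differentiating Q P = 1 turns the gauge relation of P into one for its inverse, whose transpose
    is the relation of the contragredient frame. The scalar c, the contribution of the rank one
    factor, commutes with everything. *)
Lemma dual_basis_act :
  (- A^T + c%:M) *m (Q^T *m r) + bb *: dm (Q^T *m r)
  = (Q^T *m r) *m (r *m (- M^T + c%:M) *m r).
Proof.
rewrite !mulmxA rr dmM dm_rmx mulmx0 addr0 scalemxAl -mulmxDl.
congr (_ *m _); rewrite mulmxDl mulmxDr mulNmx mulmxN -!trmx_mul scalar_mxC.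
rewrite dmT -linearZ /= dQ linearB /= addrAC; congr (_ + _).
by rewrite addrA addNr add0r.
Qed.

End DualBasis.

Lemma natmx_dual k delta (M : nat -> nat -> R) :
  natmx k (dualM k delta M) =
  rmx k *m (- (natmx k M)^T + (ps_cst (ratr delta) * bb)%:M) *m rmx k.
Proof.
apply/matrixP => i j; rewrite mulmx_rmx mul_rmx !mxE /dualM.
have -> : (rev_ord j : nat) = (k.-1 - j)%N by rewrite /=; lia.
have -> : (rev_ord i : nat) = (k.-1 - i)%N by rewrite /=; lia.
rewrite (inj_eq (can_inj (@rev_ordK _))) -val_eqE.
by case: eqP => _; rewrite ?mulr1n ?mulr0n.
Qed.

Lemma frame_dual E P Q (M : nat -> nat -> R) delta : frame P Q (natmx (rk E) M) ->
  exists P' Q', @frame (dual_tensor E (ratr delta)) P' Q' (natmx (rk E) (dualM (rk E) delta M)).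
Proof.
move=> [PQ FA]; exists (Q^T *m rmx _), (rmx _ *m P^T); split.
  exact: dual_basisK PQ.
rewrite natmx_dual Amx_dual; exact: dual_basis_act PQ FA.
Qed.

Lemma theme_form_dual k M mu delta : theme_form k M mu ->
  theme_form k (dualM k delta M) (fun i => delta - mu (k.-1 - i)%N).
Proof.
move=> [gl gd g0 gr]; split.
- move=> i j ji ik; rewrite /dualM gl ?oppr0 ?add0r; try lia.
  by case: eqP => // E; lia.
- move=> i ik; rewrite /dualM eqxx gd; last lia.
  by rewrite -mulNr -mulrDl -rmorphN -rmorphD /= addrC -rmorphB.
- move=> i ik; rewrite /dualM; have -> : (i == i.+1) = false by apply/eqP; lia.
  rewrite addr0 psNE oppr_eq0; have -> : (k.-1 - i = (k.-1 - i.+1).+1)%N by lia.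
  by apply: g0; lia.
move=> i ik; have [|p [pE Mp]] := gr (k.-1 - i.+1)%N; first lia.
exists p; rewrite /dualM; have -> : (i == i.+1) = false by apply/eqP; lia.
have E : (k.-1 - i = (k.-1 - i.+1).+1)%N by lia.
rewrite addr0 psNE oppr_eq0 E; split=> //.
have -> : mu (k.-1 - i.+1).+1 = mu (k.-1 - i.+1)%N + p%:R - 1 by rewrite -pE addrK.
ring.
Qed.

(** * The operations of Xi on series coordinates *)

Section XiCoordinates.
Implicit Types x y : xi.
Lemma xaddE x y l t : (xadd x y l t : R) = (x l t : R) + (y l t : R).
Proof. by apply: funext => n; rewrite psDE. Qed.
Lemma xscalE (S : ps) x l t : (xscal S x l t : R) = (S : R) * (x l t : R).
Proof. by apply: funext => n; rewrite psME. Qed.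
Lemma xbE x l t : (xb x l t : R) = bb * (x l t : R).
Proof. by apply: funext => -[|n]; rewrite ?bbM0 ?bbMS. Qed.
Lemma xaE x l t : (xa x l t : R) =
  bb * (ps_d (x l t : R) + ps_cst (ratr l) * (x l t : R) + (x l t.+1 : R)).
Proof.
apply: funext => -[|n]; rewrite ?bbM0 ?bbMS // !psDE ps_cstM ps_dE /=.
by rewrite mulrDl [_ * _ + _]addrC.
Qed.
End XiCoordinates.

(** * Normal submodules *)

Lemma sub_rank_closed E G j : sub_rank E G j ->
  [/\ G (vzero _), forall x y, G x -> G y -> G (vadd x y),
      forall S x, G x -> G (vscal S x) & forall x, G x -> G (aact E x)].
Proof.
move=> [N [f [[fD fZ fa] finj fG]]]; split.
- apply/fG; exists (vscal (0 : R) (vzero j)); rewrite fZ.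
  by apply: (can_inj (@tomxK _)); rewrite tomxZ scale0r tomx0.
- by move=> x y /fG[u <-] /fG[v <-]; apply/fG; exists (vadd u v).
- by move=> S x /fG[u <-]; apply/fG; exists (vscal S u).
by move=> x /fG[u <-]; apply/fG; exists (aact (ABMod N) u).
Qed.

Lemma vb_inj k : injective (@vb k).
Proof.
move=> x y E; apply: (can_inj (@tomxK k)); apply/matrixP => i j; rewrite ord1.
have := congr1 (fun x => tomx x i 0) E; rewrite !tomx_b !mxE; exact: bb_inj.
Qed.

Lemma scale_bb_inj k : injective (fun u : 'cV[R]_k => bb *: u).
Proof.
move=> u v E; apply/matrixP => i j; have := congr1 (fun w : 'cV_k => w i j) E.
by rewrite !mxE; apply: bb_inj.
Qed.

Section Flag.
Variable k : nat.
Implicit Types c : 'cV[R]_k.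

Definition flag d c := forall i : 'I_k, (d <= i)%N -> c i 0 = 0.

Lemma flagD d c c' : flag d c -> flag d c' -> flag d (c + c').
Proof. by move=> cd cd' i di; rewrite mxE cd ?cd' ?addr0. Qed.
Lemma flagZ d S c : flag d c -> flag d (S *: c).
Proof. by move=> cd i di; rewrite mxE cd ?mulr0. Qed.
Lemma flagS d c : flag d c -> flag d.+1 c.
Proof. by move=> cd i di; apply: cd; lia. Qed.
Lemma flag0 d : flag d 0.
Proof. by move=> i _; rewrite mxE. Qed.

Definition Wf d : 'M[R]_(k, d) := \matrix_(i, l) ((i : nat) == l)%:R.

Lemma Wf_E d (u : 'cV[R]_d) i :
  (Wf d *m u) i 0 = if insub (i : nat) is Some l then u l 0 else 0.
Proof.
rewrite mxE; case: insubP => [l _ li|il].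
  rewrite (bigD1 l) //= mxE li eqxx mul1r big1 ?addr0 // => t tl.
  rewrite mxE; case: eqP => [it|_]; last by rewrite mul0r.
  by case/eqP: tl; apply: val_inj; rewrite li.
rewrite big1 // => l _; rewrite mxE; case: eqP => [it|_]; last by rewrite mul0r.
by move: il; rewrite it ltn_ord.
Qed.

Lemma WfTE d (dk : (d <= k)%N) c l : ((Wf d)^T *m c) l 0 = c (widen_ord dk l) 0.
Proof.
rewrite mxE (bigD1 (widen_ord dk l)) //= !mxE eqxx mul1r big1 ?addr0 // => t tl.
rewrite !mxE; case: eqP => [tl'|_]; last by rewrite mul0r.
by case/eqP: tl; apply: val_inj.
Qed.

Lemma WfK d : (d <= k)%N -> (Wf d)^T *m Wf d = 1%:M.
Proof.
move=> dk; apply/matrixP => l t.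
have -> : ((Wf d)^T *m Wf d) l t = ((Wf d)^T *m col t (Wf d)) l 0.
  by rewrite !mxE; apply: eq_bigr => i _; rewrite !mxE.
by rewrite (WfTE dk) !mxE.
Qed.

Lemma flag_Wf d c : (d <= k)%N -> flag d c <-> exists u, c = Wf d *m u.
Proof.
move=> dk; split=> [cd|[u ->] i di]; last by rewrite Wf_E insubF // ltnNge di.
exists ((Wf d)^T *m c); apply/matrixP => i j; rewrite ord1 Wf_E.
case: insubP => [l _ li|il]; last by apply: cd; rewrite leqNgt.
by rewrite (WfTE dk); congr (c _ _); apply: val_inj.
Qed.

Variable M : nat -> nat -> R.
Hypothesis Mlow : forall i j, (j < i)%N -> (i < k)%N -> M i j = 0.

Lemma natmx_Wf d : (d <= k)%N -> natmx k M *m Wf d = Wf d *m natmx d M.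
Proof.
move=> dk; apply/matrixP => i t.
have -> : (Wf d *m natmx d M) i t = (Wf d *m col t (natmx d M)) i 0.
  by rewrite !mxE; apply: eq_bigr => l _; rewrite !mxE.
rewrite Wf_E mxE (bigD1 (widen_ord dk t)) //= !mxE eqxx mulr1 big1 ?addr0; last first.
  move=> l lt; rewrite !mxE; case: eqP => [lt'|_]; last by rewrite mulr0.
  by case/eqP: lt; apply: val_inj.
case: insubP => [l _ li|il]; first by rewrite !mxE -li.
rewrite Mlow ?ltn_ord //; apply: leq_trans (ltn_ord t) _.
by rewrite leqNgt.
Qed.

Lemma dm_Wf d : dm (Wf d) = 0.
Proof. by apply/matrixP => i j; rewrite !mxE; case: eqP; rewrite ?ps_d1 ?raddf0. Qed.

(** Modulo the previous step of the flag, a acts as on a rank one quotient. *)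
Lemma act_flag c (i : 'I_k) : flag i.+1 c ->
  (act (natmx k M) c) i 0 = M i i * c i 0 + bb * ps_d (c i 0).
Proof.
move=> ci; rewrite actE (bigD1 i) //= mxE big1 ?addr0 // => l li; rewrite mxE.
have [lt|] := ltnP l i; first by rewrite Mlow ?mul0r.
move=> il; rewrite ci ?mulr0 //.
by move: li; rewrite -val_eqE /=; lia.
Qed.

Lemma flag_act d c : flag d c -> flag d (act (natmx k M) c).
Proof.
move=> cd i di; rewrite act_flag; last by move=> l il; apply: cd; lia.
by rewrite cd // raddf0 !mulr0 addr0.
Qed.

(** Normality is [nsb]: the quotient by G has no b-torsion. *)
Record normal_sub (G : 'cV[R]_k -> Prop) : Prop := NormalSub {
  ns0 : G 0;
  nsD : forall c c', G c -> G c' -> G (c + c');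
  nsZ : forall S c, G c -> G (S *: c);
  nsA : forall c, G c -> G (act (natmx k M) c);
  nsb : forall c, G (bb *: c) -> G c }.

Variable mu : nat -> rat.
Hypothesis gM : theme_form k M mu.

Section Uniqueness.
Variable G : 'cV[R]_k -> Prop.
Hypothesis nG : normal_sub G.

Lemma normal_sub_lead (i : 'I_k) c : G c -> flag i.+1 c -> c i 0 != 0 ->
  exists m, exists2 c', G c' & flag i.+1 c' /\ c' i 0 = bb ^+ m.
Proof.
move=> Gc ci /ps_unit_part [m [U [V [E UV _]]]].
exists m, (V *: c); first exact: nsZ.
by split; [exact: flagZ | rewrite mxE E mulrCA (mulrC V) UV mulr1].
Qed.

(* With [c_i.+1 = b^m], the coefficient of b^(m+p) in the i-th coordinate of
   [(a - (mu_i.+1 + m) b) c] is that of b^p in [M i i.+1]. *)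
Lemma normal_sub_descend (i i' : 'I_k) c m : i' = i.+1 :> nat ->
  G c -> flag i'.+1 c -> c i' 0 = bb ^+ m ->
  exists2 c', G c' & flag i.+1 c' /\ c' i 0 != 0.
Proof.
move=> ii' Gc ci cm; pose s : R := ps_cst (ratr (mu i') + m%:R) * bb.
exists (act (natmx k M) c + (- s) *: c); first by apply: nsD nG _ _ _ _; [exact: nsA|exact: nsZ].
have ik : (i.+1 < k)%N by rewrite -ii'.
split=> [l il|].
  have [l2|l1] := leqP i'.+1 l.
    by rewrite mxE [X in _ + X]mxE (flag_act ci) // ci // mulr0 addr0.
  have -> : l = i' by apply: val_inj; apply: le_anti; rewrite /= !leEnat; lia.
  rewrite mxE act_flag // [X in _ + X]mxE (g_diag gM) // cm ps_d_bbX /s.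
  rewrite !rmorphD /= rmorph_nat; ring.
have [p [pE Mp]] := g_res gM ik.
suff /eqP E : (act (natmx k M) c + - s *: c) i 0 (m + p)%N = M i i.+1 p.
  by apply: contra_neq Mp => E0; rewrite -(eqP E) E0 ps0E.
rewrite mxE [X in _ + X]mxE actE.
rewrite (bigD1 i) //= (bigD1 i') /=; last by rewrite -val_eqE /= ii'; lia.
rewrite big1 ?addr0; last first.
  move=> l /andP[li li']; rewrite mxE.
  have [lt|il] := ltnP l i; first by rewrite (g_low gM) ?mul0r.
  by rewrite ci ?mulr0 //; move: li li'; rewrite -!val_eqE /=; lia.
rewrite !mxE (g_diag gM) 1?ltnW // cm ii'.
have -> : ps_cst (ratr (mu i)) * bb * c i 0 + M i i.+1 * bb ^+ m + bb * ps_d (c i 0)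
    + - s * c i 0 = bb ^+ m * M i i.+1
    + bb * (ps_d (c i 0) + ps_cst (ratr (mu i) - ratr (mu i') - m%:R) * c i 0).
  by rewrite /s !rmorphB rmorphD /=; ring.
rewrite psDE bbXM leq_addr addKn; case E : (m + p)%N => [|n]; first by rewrite bbM0 addr0.
rewrite bbMS psDE ps_dE ps_cstM -mulrDl.
have -> : n%:R + (ratr (mu i) - ratr (mu i') - m%:R) = 0 :> C.
  have -> : mu i' = mu i + p%:R - 1 by rewrite ii' -pE addrK.
  have -> : (n%:R : C) = m%:R + p%:R - 1 by rewrite -natrD E -addn1 natrD addrK.
  by rewrite rmorphB rmorphD /= rmorph1 rmorph_nat; ring.
by rewrite mul0r addr0.
Qed.

(** Subtracting a multiple of c from b^m x removes coordinate i, so b^m x lies in G; normality then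
    strips b^m. *)
Lemma normal_sub_flagS (i : 'I_k) c m : G c -> flag i.+1 c -> c i 0 = bb ^+ m ->
  (forall x, flag i x -> G x) -> forall x, flag i.+1 x -> G x.
Proof.
move=> Gc ci cm Gi x xi; have Gb : G (bb ^+ m *: x + - x i 0 *: c).
  apply: Gi => l; rewrite leq_eqVlt => /orP[/eqP il|il].
    have <- : i = l by apply: val_inj.
    by rewrite mxE [X in X + _]mxE [X in _ + X]mxE cm; ring.
  by rewrite mxE [X in X + _]mxE [X in _ + X]mxE (xi l il) (ci l il) !mulr0 addr0.
have : G (bb ^+ m *: x).
  rewrite -[_ *: x](addrK (- x i 0 *: c)) -scaleNr opprK.
  by apply: (nsD nG) => //; apply: nsZ.
elim: (m) => [|n IHn]; first by rewrite scale1r.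
by rewrite exprS -scalerA => /(nsb nG).
Qed.

(** The descent along the resonant entry produces an element of G one level lower, so the induction
    puts the lower step of the flag inside G, and the original element supplies the remaining
    coordinate. *)
Lemma normal_sub_flag (i : 'I_k) : (exists2 c, G c & flag i.+1 c /\ c i 0 != 0) ->
  forall c, flag i.+1 c -> G c.
Proof.
case: i => d dk; elim: d dk => [|d IH] dk [c Gc [ci cn0]];
  have [m [c' Gc' [c'i c'm]]] := normal_sub_lead Gc ci cn0;
  apply: (normal_sub_flagS Gc' c'i c'm) => x xi.
  have -> : x = 0 by apply/matrixP => l t; rewrite ord1 xi // mxE.
  exact: ns0.
have dk' := ltnW dk; apply: (IH dk') xi.
exact: (normal_sub_descend (i := Ordinal dk') (i' := Ordinal dk)) Gc' c'i c'm.
Qed.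

(** Going down from d = k, the search stops at the first d whose last coordinate is nonzero on some
    element of G. *)
Lemma normal_sub_is_flag : exists2 d, (d <= k)%N & forall c, G c <-> flag d c.
Proof.
suff H d : (d <= k)%N -> (forall c, G c -> flag d c) ->
    exists2 d, (d <= k)%N & forall c, G c <-> flag d c.
  by apply: (H k) => // c _ i; have := ltn_ord i; lia.
elim: d => [|d IH] dk Gd.
  exists 0%N => // c; split=> [|c0]; first exact: Gd.
  have -> : c = 0 by apply/matrixP => i j; rewrite ord1 c0 // mxE.
  exact: ns0.
pose i := Ordinal dk.
have [[c Gc ci]|H] := pselect (exists2 c, G c & c i 0 != 0).
  exists d.+1 => // x; split; first exact: Gd.
  by apply: (@normal_sub_flag i); exists c => //; split=> //; exact: Gd.
apply: IH; first exact: ltnW.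
move=> c Gc l; rewrite leq_eqVlt => /orP[/eqP dl|dl]; last exact: Gd.
have <- : i = l by apply: val_inj.
by apply/eqP; apply: contrapT => /negP ci; apply: H; exists c.
Qed.

End Uniqueness.
End Flag.

Lemma Amx_Emu mu : Amx (Emu mu) = (ps_cst mu * bb)%:M.
Proof.
apply/matrixP => i j; rewrite !ord1 !mxE; apply: funext => n.
by rewrite mulr1n ps_cstM bb.unlock /=; case: eqP => _; rewrite !mxE ?mulr1 ?mulr0 ?mulr1n.
Qed.

(** * Submodules, ranks and fundamental invariants in coordinates *)

Section Coordinates.
Variables (E : abmod) (M : 'M[R]_(rk E)).
Variables (kp : vec (rk E) -> 'cV[R]_(rk E)) (ki : 'cV[R]_(rk E) -> vec (rk E)).
Hypothesis H : coords M kp ki.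

Lemma kp0 : kp (vzero _) = 0.
Proof.
have -> : vzero (rk E) = vscal (0 : R) (vzero _).
  by apply: (can_inj (@tomxK _)); rewrite tomxZ scale0r tomx0.
by rewrite (kpZ H) scale0r.
Qed.

(** The left inverse V makes the image of W a direct summand, hence normal; the gauge relation makes
    it stable by a, with matrix N. *)
Lemma submodule_image j (W : 'M[R]_(rk E, j)) (V : 'M[R]_(j, rk E)) (N : 'M[R]_j) :
  V *m W = 1%:M -> M *m W + bb *: dm W = W *m N ->
  sub_rank E (fun x => exists u, kp x = W *m u) j /\
  normal E (fun x => exists u, kp x = W *m u).
Proof.
move=> VW MW; split.
  exists (ofAmx N), (fun x => ki (W *m tomx x)); split.
  - split.
    + by move=> x y; apply: (ki_ext H); rewrite (kpD H) !(kiK H) tomxD mulmxDr.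
    + by move=> S x; apply: (ki_ext H); rewrite (kpZ H) !(kiK H) tomxZ scalemxAr.
    move=> x; apply: (ki_ext H); rewrite (kpa H) !(kiK H).
    by rewrite (act_mulmx _ MW) (@tomx_a (ABMod (ofAmx N))) Amx_of.
  - move=> x y /(can_inj (kiK H)) /(congr1 (mulmx V)).
    by rewrite !mulmxA VW !mul1mx => /(can_inj (@tomxK _)).
  move=> y; split=> [[u yu]|[x <-]]; last by exists (tomx x); rewrite (kiK H).
  by exists (ofmx u); apply: (ki_ext H); rewrite (kiK H) ofmxK.
move=> y; split=> [[[u yu] [z yz]]|[z [[u zu] yz]]].
  exists z; split=> //; exists (V *m kp z); apply: scale_bb_inj.
  rewrite -(kpb H) -yz yu scalemxAr scalemxAr -(kpb H) -yz yu.
  by rewrite (mulmxA V) VW mul1mx.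
split; last by exists z.
by exists (bb *: u); rewrite yz (kpb H) zu scalemxAr.
Qed.

Lemma normal_sub_coords (MM : nat -> nat -> R) G j : M = natmx _ MM ->
  sub_rank E G j -> normal E G -> normal_sub MM (fun c => G (ki c)).
Proof.
move=> ME Gj nG; have [G0 GD GZ GA] := sub_rank_closed Gj; split.
- by have -> : ki 0 = vzero _ by apply: (ki_ext H); rewrite (kiK H) kp0.
- move=> c c' Gc Gc'; have -> : ki (c + c') = vadd (ki c) (ki c').
    by apply: (ki_ext H); rewrite (kpD H) !(kiK H).
  exact: GD.
- move=> S c Gc; have -> : ki (S *: c) = vscal S (ki c).
    by apply: (ki_ext H); rewrite (kpZ H) !(kiK H).
  exact: GZ.
- move=> c Gc; have -> : ki (act (natmx _ MM) c) = aact E (ki c).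
    by apply: (ki_ext H); rewrite (kpa H) !(kiK H) ME.
  exact: GA.
move=> c; have -> : ki (bb *: c) = vb (ki c).
  by apply: (ki_ext H); rewrite (kpb H) !(kiK H).
move=> Gc; have [z [Gz /vb_inj ->]] // := (nG (vb (ki c))).1 (conj Gc (ex_intro _ _ erefl)).
Qed.

(** Invariance of rank: two injective parametrisations of one submodule factor through each other,
    and mutually inverse matrices over a nonzero commutative ring are square. *)
Lemma sub_rank_flag G j d : (d <= rk E)%N -> sub_rank E G j ->
  (forall c, G (ki c) <-> flag d c) -> j = d.
Proof.
move=> dk [N [f [[fD fZ fa] finj fG]]] Gd; set k := rk E in dk.
have f0 : f (vzero j) = vzero _.
  have -> : vzero j = vscal (0 : R) (vzero j).
    by apply: (can_inj (@tomxK _)); rewrite tomxZ scale0r tomx0.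
  by rewrite fZ; apply: (can_inj (@tomxK _)); rewrite tomxZ scale0r tomx0.
pose g (u : 'cV[R]_j) : 'cV[R]_k := kp (f (ofmx u)).
have gD u v : g (u + v) = g u + g v.
  by rewrite /g -(kpD H) -fD; congr (kp (f _)); apply: (can_inj (@tomxK _));
    rewrite tomxD !ofmxK.
have gZ S u : g (S *: u) = S *: g u.
  by rewrite /g -(kpZ H) -fZ; congr (kp (f _)); apply: (can_inj (@tomxK _));
    rewrite tomxZ !ofmxK.
have g0 : g 0 = 0 by rewrite -(scale0r (0 : 'cV[R]_j)) gZ scale0r.
have gE u : g u = (\matrix_(i, l) g (delta_mx l 0) i 0) *m u.
  rewrite [in LHS](_ : u = \sum_l u l 0 *: delta_mx l 0); last first.
    by rewrite [LHS]matrix_sum_delta; apply: eq_bigr => l _; rewrite big_ord1.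
  rewrite (big_morph g gD g0); apply/matrixP => i t; rewrite ord1 summxE mxE.
  by apply: eq_bigr => l _; rewrite gZ !mxE mulrC.
set B := \matrix_(i, l) _ in gE.
have gflag c : flag d c <-> exists u, c = B *m u.
  rewrite -Gd fG; split=> [[x xE]|[u ->]].
    by exists (tomx x); rewrite -gE /g tomxK xE (kiK H).
  by exists (ofmx u); rewrite -gE /g (kpK H).
have ginj (u v : 'cV[R]_j) : B *m u = B *m v -> u = v.
  rewrite -!gE /g => /(can_inj (kpK H)) /finj; exact: (can_inj (@ofmxK _)).
have [V VE] : exists V : 'M[R]_(j, d), Wf k d = B *m V.
  have [|V VE] := @choice _ _ (fun (l : 'I_d) u => col l (Wf k d) = B *m u).
    move=> l; apply/gflag/flag_Wf => //; exists (delta_mx l 0).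
    by rewrite colE.
  exists (\matrix_(i, l) V l i 0); apply/matrixP => i l.
  have := congr1 (fun c : 'cV_k => c i 0) (VE l); rewrite !mxE => ->.
  by apply: eq_bigr => t _; rewrite !mxE.
have [V' V'E] : exists V' : 'M[R]_(d, j), B = Wf k d *m V'.
  have [|V' V'E] := @choice _ _ (fun (l : 'I_j) u => col l B = Wf k d *m u).
    move=> l; apply/flag_Wf => //; apply/gflag; exists (delta_mx l 0).
    by rewrite colE.
  exists (\matrix_(i, l) V' l i 0); apply/matrixP => i l.
  have := congr1 (fun c : 'cV_k => c i 0) (V'E l); rewrite !mxE => ->.
  by apply: eq_bigr => t _; rewrite !mxE.
have VV' : V *m V' = 1%:M.
  apply/matrixP => l t; have : col t (V *m V') = col t 1%:M.
    by apply: ginj; rewrite !colE !mulmxA -VE -V'E mulmx1.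
  have cE (X : 'M[R]_j) : col t X l 0 = X l t by rewrite mxE.
  by move/matrixP => /(_ l 0); rewrite !cE.
have V'V : V' *m V = 1%:M.
  by rewrite -[V' *m V]mul1mx -(WfK dk) -!mulmxA (mulmxA (Wf k d)) -V'E -VE WfK.
by apply: anti_leq; rewrite (mulmx1_min VV') (mulmx1_min V'V).
Qed.

Lemma theme_form_fund_inv (MM : nat -> nat -> R) (ls : seq rat) : M = natmx _ MM ->
  theme_form (rk E) MM (nth 0 ls) -> size ls = rk E -> fund_inv E ls.
Proof.
move=> ME gM sz; split=> //; set k := rk E in sz *.
have low := g_low gM.
exists (fun j x => flag j (kp x)); split.
- move=> j jk.
  have -> : (fun x => flag j (kp x)) = (fun x => exists u, kp x = Wf k j *m u).
    by apply: funext => x; apply/propext; apply: flag_Wf.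
  apply: (submodule_image (V := (Wf k j)^T) (N := natmx j MM)); first exact: WfK.
  by rewrite dm_Wf scaler0 addr0 ME natmx_Wf.
- by move=> j jk x; apply: flagS.
- by move=> x i; rewrite leqNgt ltn_ord.
- move=> j G jk Gj nG x; have nsG := normal_sub_coords ME Gj nG.
  have [d dk Gd] := normal_sub_is_flag low gM nsG.
  have jd := sub_rank_flag dk Gj Gd.
  by rewrite jd -Gd (kpK H).
move=> j /andP[j0 jk]; have jk' : (j.-1 < k)%N by lia.
pose i := Ordinal jk'.
have ij (x : vec k) : flag j (kp x) -> flag i.+1 (kp x).
  by move=> xj l il; apply: xj; move: il => /=; lia.
have tE (x : vec k) : tomx (ofmx (const_mx (kp x i 0) : 'cV[R]_1)) = const_mx (kp x i 0).
  exact: ofmxK.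
(* The quotient map reads the last coordinate that can be nonzero on F_j, whose index is j - 1 as
   coordinates start at 0. *)
exists (fun x => ofmx (const_mx (kp x i 0) : 'cV[R]_1)); split.
- move=> x y _ _; apply: (can_inj (@tomxK _)); rewrite tomxD !ofmxK (kpD H).
  by apply/matrixP => s t; rewrite !mxE.
- move=> S x _; apply: (can_inj (@tomxK _)); rewrite tomxZ !ofmxK (kpZ H).
  by apply/matrixP => s t; rewrite !mxE.
- move=> x /ij xi; apply: (can_inj (@tomxK _)).
  rewrite (@tomx_a (Emu _)) !ofmxK Amx_Emu (kpa H) ME; apply/matrixP => s t.
  rewrite mxE (act_flag low xi) act.unlock !mxE big_ord1 !mxE (g_diag gM) //.
  by rewrite [s]ord1 eqxx mulr1n.
- move=> z; exists (ki (tomx z 0 0 *: delta_mx i 0)).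
    rewrite (kiK H) => l jl; rewrite !mxE; case: eqP => [li|_]; last by rewrite mulr0.
    by move: jl; rewrite li /=; lia.
  rewrite (kiK H) !mxE !eqxx mulr1; apply: (can_inj (@tomxK _)); rewrite ofmxK.
  by apply/matrixP => s t; rewrite !ord1 !mxE.
move=> x xj; split=> [/(congr1 (@tomx _)) E0 l|xj'].
  have xi0 : kp x i 0 = 0.
    by have := congr1 (fun u : 'cV_1 => u 0 0) E0; rewrite ofmxK tomx0 !mxE.
  move=> jl; have [->//|li] := eqVneq l i; apply: xj.
  by move: jl li; rewrite -val_eqE /=; lia.
apply: (can_inj (@tomxK _)); by rewrite ofmxK tomx0 xj'.
Qed.

End Coordinates.

(** * Maps to Xi *)

Lemma xi_ext (x y : xi) : (forall l t n, x l t n = y l t n) -> x = y.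
Proof. by move=> E; do 3!apply: funext => ?. Qed.

Section XiMaps.
Variables (E : abmod) (M : 'M[R]_(rk E)).
Variables (kp : vec (rk E) -> 'cV[R]_(rk E)) (ki : 'cV[R]_(rk E) -> vec (rk E)).
Hypothesis H : coords M kp ki.
Variable f : vec (rk E) -> xi.
Hypotheses (fD : forall x y, f (vadd x y) = xadd (f x) (f y))
  (fZ : forall S x, f (vscal S x) = xscal S (f x))
  (fa : forall x, f (aact E x) = xa (f x)).

Let g (c : 'cV[R]_(rk E)) (l : rat) (t : nat) : R := f (ki c) l t.

Let gD c c' l t : g (c + c') l t = g c l t + g c' l t.
Proof.
have kiD : ki (c + c') = vadd (ki c) (ki c').
  by apply: (ki_ext H); rewrite (kpD H) !(kiK H).
by rewrite /g kiD fD xaddE.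
Qed.

Let gZ S c l t : g (S *: c) l t = S * g c l t.
Proof.
have kiZ : ki (S *: c) = vscal S (ki c).
  by apply: (ki_ext H); rewrite (kpZ H) !(kiK H).
by rewrite /g kiZ fZ xscalE.
Qed.

Let g0 l t : g 0 l t = 0.
Proof. by rewrite -(scale0r (0 : 'cV[R]_(rk E))) gZ mul0r. Qed.

Let g_sum (I : Type) (r : seq I) (P : pred I) (F : I -> 'cV[R]_(rk E)) l t :
  g (\sum_(i <- r | P i) F i) l t = \sum_(i <- r | P i) g (F i) l t.
Proof. exact: (big_morph (fun c => g c l t) (fun c c' => gD c c' l t) (g0 l t)). Qed.

Let gE c l t : g c l t = \sum_i c i 0 * g (delta_mx i 0) l t.
Proof.
rewrite {1}[c]matrix_sum_delta g_sum; apply: eq_bigr => i _.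
by rewrite big_ord1 gZ.
Qed.

(** This is b-adic continuity: by linearity the map is determined by the finitely many images of
    basis vectors, so no high power of b contributes to coefficient n. *)
Let g_cf n c c' l t : (forall m, (m <= n)%N -> cf m c = cf m c') ->
  g c l t n = g c' l t n.
Proof.
move=> cc'; rewrite !gE !ps_sumE; apply: eq_bigr => i _; rewrite !psME.
by apply: eq_bigr => j _; rewrite -!cfE cc' // -ltnS.
Qed.

Let f_a c : f (ki (act M c)) = xa (f (ki c)).
Proof.
rewrite -fa; congr f; apply: (ki_ext H); rewrite (kpa H) !(kiK H) //.
Qed.

Let f_iter_a i c : f (ki (iter i (act M) c)) = iter i xa (f (ki c)).
Proof. by elim: i => // i IH; rewrite !iterS f_a IH. Qed.

Let f_bb v c : f (ki (bb ^+ v *: c)) = iter v xb (f (ki c)).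
Proof.
elim: v => [|v IH]; first by rewrite scale1r.
rewrite exprS -scalerA iterS -IH; do 2!apply: funext => ?.
by rewrite [LHS]gZ -[RHS]/(xb _ _ _ : R) xbE.
Qed.

Lemma xpoly_polop P c l t n :
  (f (ki (polop (act M) P c)) l t : R) n = xpoly P (f (ki c)) l t n.
Proof.
rewrite -[f _ l t]/(g _ l t) polop.unlock g_sum ps_sumE; apply: eq_bigr => i _.
by rewrite gZ ps_cstM /g f_iter_a.
Qed.

Lemma f_op_series P c l t n : (f (ki (op_series M P c)) l t : R) n =
  \sum_(v < n.+1) xpoly (P v) (iter v xb (f (ki c))) l t n.
Proof.
rewrite -[f _ l t]/(g _ l t).
rewrite (@g_cf n _ (\sum_(v < n.+1) polop (act M) (P v) (bb ^+ v *: c))).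
  rewrite g_sum ps_sumE; apply: eq_bigr => v _.
  by rewrite /g xpoly_polop f_bb.
by move=> m mn; rewrite (cf_op_series _ _ _ mn).
Qed.

Lemma Agen_op_series c psi : Agen (f (ki c)) psi <-> exists P, f (ki (op_series M P c)) = psi.
Proof.
split=> [[P PE]|[P <-]]; exists P; last by move=> l t n; exact: f_op_series.
by apply: xi_ext => l t n; rewrite PE; exact: f_op_series.
Qed.

Lemma cyclic_is_theme c : in_Xi (f (ki c)) -> injective f -> cyclic_mod_b M c ->
  is_theme E.
Proof.
move=> Xic finj cyc; exists (f (ki c)); split=> //; exists f; split=> // psi.
split=> [/Agen_op_series[P <-]|[x <-]]; first by exists (ki (op_series M P c)).
by apply/Agen_op_series; have [P PE] := op_series_surj (kp x) cyc; exists P; rewrite PE (kpK H).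
Qed.

End XiMaps.

Lemma Agen_refl phi : Agen phi phi.
Proof.
exists (fun v => if v == 0%N then 1 else 0) => l t n.
rewrite big_ord_recl /= big1 ?addr0; last first.
  by move=> i _; rewrite /xpoly /= size_poly0 big_ord0.
by rewrite /xpoly size_poly1 big_ord1 coef1 mul1r.
Qed.

(** A preimage of the generator phi generates E, and modulo b only the term P_0(a) of a series sum_v
    P_v(a) b^v survives. *)
Lemma theme_cyclic E M kp ki : @coords E M kp ki -> is_theme E ->
  exists c, cyclic_mod_b M c.
Proof.
move=> H [phi [_ [f [fD fZ fa finj fA]]]].
have [x0 x0E] := (fA phi).1 (Agen_refl phi).
exists (kp x0) => w; pose c : 'cV[R]_(rk E) := \col_i ps_cst (w i 0).
have [P PE] : exists P, f (ki (op_series M P (kp x0))) = f (ki c).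
  apply/(Agen_op_series H fD fZ fa); rewrite (kpK H) x0E; apply/fA; by exists (ki c).
exists (P 0%N); rewrite -cf0_op_series.
have -> : op_series M P (kp x0) = c by apply: (can_inj (kiK H)); apply: finj.
by apply/matrixP => i j; rewrite ord1 !mxE ps_cstE.
Qed.

Lemma natmxP k (N : 'M[R]_k) : exists M, natmx k M = N.
Proof.
exists (fun i j => if insub i is Some i' then if insub j is Some j' then N i' j' else 0 else 0).
by apply/matrixP => i j; rewrite mxE !valK.
Qed.

(** * Adapted bases of a theme *)

Section AdaptedBasis.
Variables (E : abmod) (ls : seq rat) (F : nat -> vec (rk E) -> Prop).
Local Notation k := (rk E).
Hypothesis Fsub : forall j, (j <= k)%N -> sub_rank E (F j) j.
Hypothesis Ftop : forall x, F k x.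
Hypothesis Fquot : forall j, (0 < j <= k)%N ->
  quot_iso E (F j) (F j.-1) (Emu (ratr (nth 0 ls j.-1))).
Local Notation mu i := (ratr (nth 0 ls i) : C).

Let F' j (u : 'cV[R]_k) := F j (ofmx u).

Let F'D j u v : (j <= k)%N -> F' j u -> F' j v -> F' j (u + v).
Proof.
move=> jk Fu Fv; have [_ FD _ _] := sub_rank_closed (Fsub jk).
have := FD _ _ Fu Fv; congr F; apply: (can_inj (@tomxK _)).
by rewrite tomxD !ofmxK.
Qed.

Let F'Z j S u : (j <= k)%N -> F' j u -> F' j (S *: u).
Proof.
move=> jk Fu; have [_ _ FZ _] := sub_rank_closed (Fsub jk).
have := FZ S _ Fu; congr F; apply: (can_inj (@tomxK _)).
by rewrite tomxZ !ofmxK.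
Qed.

Let F'A j u : (j <= k)%N -> F' j u -> F' j (act (Amx E) u).
Proof.
move=> jk Fu; have [_ _ _ FA] := sub_rank_closed (Fsub jk).
have := FA _ Fu; congr F; apply: (can_inj (@tomxK _)).
by rewrite tomx_a !ofmxK.
Qed.

Let F'0 u : F' 0 u -> u = 0.
Proof.
have [N [f [[fD fZ fa] _ fF]]] := Fsub (leq0n k).
move=> /fF[x xE]; rewrite -[u]ofmxK -xE.
have -> : x = vscal (0 : R) x by apply: funext => n; apply/matrixP => -[].
by rewrite fZ tomxZ scale0r.
Qed.

(** Here p lifts the generator of the rank one quotient, and S is the image of u in that
    quotient. *)
Let basis_vector (i : 'I_k) : exists p, [/\ F' i.+1 p,
  forall u, F' i.+1 u -> exists S, F' i (u + - S *: p)
  & F' i (act (Amx E) p + - (ps_cst (mu i) * bb) *: p)].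
Proof.
have ik : (0 < i.+1 <= k)%N by rewrite /= ltn_ord.
have [g [gD gZ ga gs gQ]] := Fquot ik; move: gD gZ ga gs gQ; rewrite [i.+1.-1]/= => gD gZ ga gs gQ.
have ik' : (i.+1 <= k)%N := ltn_ord i.
have [p Fp pE] := gs (ofmx (const_mx 1 : 'cV[R]_1)).
pose h (u : 'cV[R]_k) : R := tomx (g (ofmx u)) 0 0.
have hp : h (tomx p) = 1 by rewrite /h tomxK pE ofmxK mxE.
have hD u v : F' i.+1 u -> F' i.+1 v -> h (u + v) = h u + h v.
  move=> Fu Fv; rewrite /h.
  have -> : ofmx (u + v) = vadd (ofmx u) (ofmx v).
    by apply: (can_inj (@tomxK _)); rewrite tomxD !ofmxK.
  by rewrite gD // tomxD mxE.
have hZ S u : F' i.+1 u -> h (S *: u) = S * h u.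
  move=> Fu; rewrite /h; have -> : ofmx (S *: u) = vscal S (ofmx u).
    by apply: (can_inj (@tomxK _)); rewrite tomxZ !ofmxK.
  by rewrite gZ // tomxZ mxE.
have ha u : F' i.+1 u -> h (act (Amx E) u) = ps_cst (mu i) * bb * h u + bb * ps_d (h u).
  move=> Fu; rewrite /h; have -> : ofmx (act (Amx E) u) = aact E (ofmx u).
    by apply: (can_inj (@tomxK _)); rewrite tomx_a !ofmxK.
  rewrite ga // (@tomx_a (Emu _)) Amx_Emu actE big_ord1 !mxE eqxx mulr1n //.
have h0 u : F' i.+1 u -> h u = 0 -> F' i u.
  move=> Fu hu; apply/gQ => //; apply: (can_inj (@tomxK _)); rewrite tomx0.
  by apply/matrixP => s t; rewrite !ord1 [RHS]mxE -hu.
have Fp' : F' i.+1 (tomx p) by rewrite /F' tomxK.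
exists (tomx p); split=> //.
  move=> u Fu; exists (h u); apply: h0; first by apply: F'D => //; apply: F'Z.
  by rewrite hD ?hZ ?hp ?mulr1 ?subrr //; apply: F'Z.
have FAp := F'A ik' Fp'; apply: h0; first by apply: F'D => //; apply: F'Z.
rewrite hD ?hZ ?ha ?hp ?ps_d1 //; last by apply: F'Z.
by rewrite mulr0 addr0 mulNr subrr.
Qed.

(** Lifts of the generators of the successive quotients span every F_d by induction on d. As the
    last step is the whole module, the standard basis vectors have coordinates in these lifts, and
    these coordinates are the columns of Q. *)
Lemma adapted_basis : exists P Q M, [/\ frame P Q (natmx k M),
  forall i j, (j < i)%N -> (i < k)%N -> M i j = 0,
  forall i, (i < k)%N -> M i i = ps_cst (mu i) * bb
  & forall j x, (j <= k)%N -> F j x -> flag j (Q *m tomx x)].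
Proof.
have [p /all_and3[pF pS pA]] := choice basis_vector.
pose P : 'M[R]_k := \matrix_(i, j) p j i 0.
have PE j : P *m delta_mx j 0 = p j.
  by rewrite -colE; apply/matrixP => i t; rewrite ord1 !mxE.
have span d u : (d <= k)%N -> F' d u -> exists2 c, flag d c & u = P *m c.
  elim: d u => [|d IH] u dk Fu.
    by exists 0; [exact: flag0 | rewrite mulmx0 (F'0 Fu)].
  pose i := Ordinal dk; have [S FS] := pS i u Fu.
  have [c cd cE] := IH _ (ltnW dk) FS.
  exists (c + S *: delta_mx i 0).
    apply: flagD; first exact: flagS.
    move=> l dl; rewrite !mxE; case: eqP => [li|_]; last by rewrite mulr0.
    by move: dl; rewrite li ltnn.
  by rewrite mulmxDr -cE -scalemxAr PE scaleNr subrK.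
have [|q qE] := @choice 'I_k 'cV[R]_k (fun l c => delta_mx l 0 = P *m c).
  by move=> l; have [c _ cE] := span k (delta_mx l 0) (leqnn k) (Ftop _); exists c.
pose Q : 'M[R]_k := \matrix_(i, j) q j i 0.
have PQ : P *m Q = 1%:M.
  apply/matrixP => i j; have := congr1 (fun u : 'cV_k => u i 0) (qE j).
  rewrite !mxE eqxx andbT => ->.
  by apply: eq_bigr => l _; rewrite !mxE.
have [|c cE] := @choice 'I_k 'cV[R]_k (fun j c => flag j c /\
    act (Amx E) (p j) + - (ps_cst (mu j) * bb) *: p j = P *m c).
  by move=> j; have [c cj cE] := span j _ (ltnW (ltn_ord j)) (pA j); exists c.
(* The vector [c j] only involves indices below j: it gives the part strictly above the diagonal. *)
pose N : 'M[R]_k := \matrix_(i, j) (c j i 0 + (ps_cst (mu j) * bb) *+ (i == j)).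
have FA : Amx E *m P + bb *: dm P = P *m N.
  apply/matrixP => i j.
  have -> : (Amx E *m P + bb *: dm P) i j = act (Amx E) (p j) i 0.
    rewrite actE !mxE; congr (_ + _); apply: eq_bigr => l _; rewrite !mxE //.
  have -> : act (Amx E) (p j) = P *m (c j + (ps_cst (mu j) * bb) *: delta_mx j 0).
    rewrite mulmxDr -(cE j).2 -scalemxAr PE scaleNr.
    by rewrite -[LHS](subrK ((ps_cst (mu j) * bb) *: p j)).
  rewrite !mxE; apply: eq_bigr => l _; rewrite !mxE eqxx andbT.
  by case: eqP => _; rewrite ?mulr1n ?mulr0n ?mulr1 ?mulr0.
have [M ME] := natmxP N; exists P, Q, M; rewrite ME; split=> //.
- move=> i j ji ik; have jk := ltn_trans ji ik.
  have := congr1 (fun X : 'M_k => X (Ordinal ik) (Ordinal jk)) ME.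
  have -> : natmx k M (Ordinal ik) (Ordinal jk) = M i j by rewrite mxE.
  move=> ->; have c0 := (cE (Ordinal jk)).1 (Ordinal ik) (ltnW ji).
  have ij : (Ordinal ik == Ordinal jk) = false by rewrite -val_eqE /= gtn_eqF.
  by rewrite mxE c0 ij mulr0n addr0.
- move=> i ik; have := congr1 (fun X : 'M_k => X (Ordinal ik) (Ordinal ik)) ME.
  have -> : natmx k M (Ordinal ik) (Ordinal ik) = M i i by rewrite mxE.
  have c0 := (cE (Ordinal ik)).1 (Ordinal ik) (leqnn i).
  by move=> ->; rewrite mxE c0 eqxx mulr1n add0r.
move=> j x jk Fx; have [|d dj dE] := span j (tomx x) jk; first by rewrite /F' tomxK.
by rewrite dE mulmxA (mulmx1C PQ) mul1mx.
Qed.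

End AdaptedBasis.

(** * Normal submodules spanned by a step of the flag and one vector *)

Section ExtendFlag.
Variables (k i : nat) (ik : (i < k)%N) (M : nat -> nat -> R) (w : 'cV[R]_k) (s Y : R).
Hypothesis low : forall i j, (j < i)%N -> (i < k)%N -> M i j = 0.
Hypothesis wY : Y * w (Ordinal ik) 0 = 1.
Hypothesis w0 : forall l : 'I_k, (l < i)%N -> w l 0 = 0.
Hypothesis wa : flag i (act (natmx k M) w - s *: w).

Let W : 'M[R]_(k, i.+1) := \matrix_(l, t) if (t < i)%N then ((l : nat) == t)%:R else w l 0.
Let trunc (u : 'cV[R]_i.+1) : 'cV[R]_i := \col_t u (widen_ord (leqnSn i) t) 0.

Let WE u : W *m u = Wf k i *m trunc u + u ord_max 0 *: w.
Proof.
apply/matrixP => l j; rewrite ord1 !mxE big_ord_recr /= !mxE /= ltnn mulrC.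
congr (_ + _); apply: eq_bigr => t _; by rewrite !mxE /= ltn_ord.
Qed.

Let colW_lt (t : 'I_i.+1) : (t < i)%N ->
  col t W = delta_mx (widen_ord ik t) 0.
Proof.
move=> ti; apply/matrixP => l j; rewrite ord1 !mxE ti eqxx andbT.
by rewrite -val_eqE.
Qed.

Let colW_max (t : 'I_i.+1) : (i <= t)%N -> col t W = w.
Proof. by move=> it; apply/matrixP => l j; rewrite ord1 !mxE ltnNge it. Qed.

Let V : 'M[R]_(i.+1, k) :=
  \matrix_(t, l) ((if (t < i)%N then 1 else Y) * ((l : nat) == t)%:R).

Let VE (x : 'cV[R]_k) (t : 'I_i.+1) : (V *m x) t 0 =
  (if (t < i)%N then 1 else Y) * x (widen_ord ik t) 0.
Proof.
rewrite mxE (bigD1 (widen_ord ik t)) //= mxE eqxx mulr1 big1 ?addr0 // => l lt.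
rewrite mxE; case: eqP => [E|]; last by rewrite mulr0 mul0r.
by case/eqP: lt; apply: val_inj.
Qed.

Let VW : V *m W = 1%:M.
Proof.
apply/matrixP => t t'.
have -> : (V *m W) t t' = (V *m col t' W) t 0.
  by rewrite !mxE; apply: eq_bigr => l _; rewrite !mxE.
rewrite VE [RHS]mxE; have [ti'|it'] := ltnP t' i.
  rewrite colW_lt // !mxE eqxx andbT -val_eqE /= -val_eqE /=.
  case: ifP => ti; first by rewrite mul1r.
  have /negPf -> : (t : nat) != t' by apply/eqP => E; move: ti; rewrite E ti'.
  by rewrite mulr0.
have Et' : t' = i :> nat by have := ltn_ord t'; lia.
rewrite colW_max // -val_eqE /= Et'; have [ti|it] := ltnP t i.
  by rewrite w0 // mulr0 ltn_eqF.
have Et : t = i :> nat by have := ltn_ord t; lia.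
rewrite Et eqxx -wY; congr (_ * w _ _); exact: val_inj.
Qed.

Let N : 'M[R]_i.+1 := \matrix_(t, t')
  if (t' < i)%N then M t t'
  else if (t < i)%N then (act (natmx k M) w - s *: w) (widen_ord ik t) 0 else s.

Let MW : natmx k M *m W + bb *: dm W = W *m N.
Proof.
have ik' : (i <= k)%N by apply: ltnW.
apply/matrixP => l t.
have -> : (natmx k M *m W + bb *: dm W) l t = act (natmx k M) (col t W) l 0.
  by rewrite actE !mxE; congr (_ + _); apply: eq_bigr => a _; rewrite !mxE.
have -> : (W *m N) l t = (W *m col t N) l 0.
  by rewrite !mxE; apply: eq_bigr => a _; rewrite !mxE.
rewrite WE mxE Wf_E [X in _ + X]mxE; have [ti|it] := ltnP t i.
  rewrite colW_lt // actE (bigD1 (widen_ord ik t)) //= big1 ?addr0; last first.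
    by move=> a /negPf at'; rewrite mxE (_ : delta_mx _ _ _ _ = 0) ?mulr0 // mxE at'.
  have -> : col t N ord_max 0 = 0 by rewrite !mxE ti /= low.
  have -> : ps_d ((delta_mx (widen_ord ik t) 0 : 'cV[R]_k) l 0) = 0.
    by rewrite mxE; case: (_ && _); rewrite ?ps_d1 ?raddf0.
  rewrite mulr0 addr0 mul0r addr0.
  have -> : (delta_mx (widen_ord ik t) 0 : 'cV[R]_k) (widen_ord ik t) 0 = 1.
    by rewrite mxE !eqxx.
  rewrite mulr1 mxE; case: insubP => [t' _ <-|li]; first by rewrite /trunc !mxE /= ti.
  by apply: low => //; rewrite -leqNgt in li; apply: leq_trans ti li.
have Et : t = i :> nat by have := ltn_ord t; lia.
rewrite colW_max //.
have -> : col t N ord_max 0 = s by rewrite !mxE ltnNge it /= ltnn.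
have cE : act (natmx k M) w l 0 = (act (natmx k M) w - s *: w) l 0 + s * w l 0.
  by rewrite [in RHS]mxE [X in _ + X + _]mxE [X in _ - X + _]mxE subrK.
rewrite {}cE; congr (_ + _); case: insubP => [t' ti' t'l|li].
  rewrite /trunc [RHS]mxE [RHS]mxE [RHS]mxE ltnNge it /= ltn_ord.
  by congr (fun_of_matrix _ _ _); apply: val_inj.
by apply: wa; rewrite leqNgt.
Qed.

(** The sum F_i + C[[b]] w is stable because w is an eigenvector modulo F_i, and a direct summand
    because coordinate i of w is a unit: V reads coordinates 0 to i, multiplying the last by the
    inverse Y. *)
Lemma extend_flag : exists (W : 'M[R]_(k, i.+1)) V N, [/\ V *m W = 1%:M,
  natmx k M *m W + bb *: dm W = W *m N & exists u, W *m u = w].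
Proof.
exists W, V, N; split; [exact: VW | exact: MW |].
by exists (delta_mx ord_max 0); rewrite -colE colW_max.
Qed.

End ExtendFlag.

(* If the resonant coefficient vanished, [w = b e_i.+1 - Z e_i] would be a
   second eigenvector modulo F_i, and F_i + C[[b]] w a second normal submodule of
   rank i+1. *)
Lemma resonance E (M : nat -> nat -> R) kp ki (mu : nat -> rat) i :
  coords (natmx (rk E) M) kp ki ->
  (forall i j, (j < i)%N -> (i < rk E)%N -> M i j = 0) ->
  (forall i, (i < rk E)%N -> M i i = ps_cst (ratr (mu i)) * bb) ->
  (i.+1 < rk E)%N -> M i i.+1 0%N != 0 ->
  (forall G, sub_rank E G i.+1 -> normal E G -> forall x, G x -> flag i.+1 (kp x)) ->
  exists p : nat, mu i.+1 + 1 = mu i + p%:R /\ M i i.+1 p != 0.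
Proof.
move=> H low diag ik s0 uniq; set k := rk E in ik low diag *; apply: contrapT => nres.
pose S := M i i.+1; pose e : C := ratr (mu i.+1 + 1 - mu i).
have Se n : n%:R = e -> S n = 0.
  move=> ne; apply/eqP; apply: contrapT => /negP Sn; apply: nres; exists n; split=> //.
  suff -> : (n%:R : rat) = mu i.+1 + 1 - mu i by ring.
  by apply: (fmorph_inj (ratr : {rmorphism rat -> C})); rewrite /= rmorph_nat.
(* Coefficientwise solution of b Z' - e Z = S. At a resonance n = e the assumed vanishing of S n
   makes the equation trivial, and the quotient by zero does no harm. *)
pose Z : R := fun n => S n / (n%:R - e).
have ZE n : S n = (n%:R - e) * Z n.
  rewrite /Z mulrC; have [ne|ne] := eqVneq (n%:R - e) 0.
    by rewrite Se ?mul0r //; apply/eqP; rewrite -subr_eq0 ne.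
  by rewrite divfK.
(* So Z is a unit: the invertible coordinate needed to extend the flag by w. *)
have Z0 : Z 0%N != 0.
  by apply: contraNneq s0 => Z0; rewrite -[M i i.+1]/S ZE Z0 mulr0.
have SZ : S = ps_d Z - ps_cst e * Z.
  by apply: funext => n; rewrite psBE ps_dE ps_cstM -mulrBl.
have [Y ZY] := ps_inv Z0.
have ik' : (i < k)%N by apply: ltnW.
pose oi := Ordinal ik'; pose oi1 := Ordinal ik.
pose w : 'cV[R]_k := bb *: delta_mx oi1 0 - Z *: delta_mx oi 0.
(* The eigenvalue is that of b e_{i+1}, one more than that of e_{i+1} because a b = b (a + b). *)
pose c := act (natmx k M) w - (ps_cst (ratr (mu i.+1 + 1)) * bb) *: w.
have wE (l : 'I_k) : w l 0 = bb *+ (l == oi1) - Z *+ (l == oi).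
  by rewrite !mxE !andbT; do 2 case: (_ == _); rewrite ?mulr1n ?mulr0n ?mulr1 ?mulr0.
have wflag : flag i.+2 w.
  move=> l il; rewrite wE -!val_eqE /=.
  have /negPf -> : (l : nat) != i.+1 by lia.
  have /negPf -> : (l : nat) != i by lia.
  by rewrite subr0.
have cflag : flag i c.
  move=> l; rewrite leq_eqVlt => /orP[/eqP il|].
    have <- : oi = l by apply: val_inj.
    rewrite mxE [X in _ + X]mxE [X in _ - X]mxE actE (bigD1 oi) //= (bigD1 oi1) //=; last first.
      by rewrite -val_eqE /=; lia.
    rewrite big1 ?addr0; last first.
      move=> t /andP[ti ti1]; rewrite wE (negPf ti) (negPf ti1) subr0 mulr0 //.
    have wi : w oi 0 = - Z by rewrite wE eqxx mulr1n -val_eqE /= ltn_eqF // mulr0n sub0r.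
    have wi1 : w oi1 0 = bb by rewrite wE eqxx mulr1n -val_eqE /= gtn_eqF // mulr0n subr0.
    rewrite wi wi1 !mxE diag // -/S SZ raddfN /= -!/(ps_d Z).
    have -> : ps_cst (ratr (mu i.+1 + 1)) = ps_cst e + ps_cst (ratr (mu i)) :> R.
      by rewrite -rmorphD /= /e -rmorphD subrK.
    by ring.
  move=> il; rewrite mxE [X in _ + X]mxE [X in _ - X]mxE.
  have [l1|l2] := leqP l i.+1.
    have <- : oi1 = l by apply: val_inj => /=; lia.
    have wi1 : w oi1 0 = bb by rewrite wE eqxx mulr1n -val_eqE /= gtn_eqF // mulr0n subr0.
    rewrite (@act_flag k M low w oi1 wflag) wi1 diag // ps_d_bb rmorphD rmorph1 rmorphD rmorph1 /=.
    by ring.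
  rewrite (flag_act low wflag) // wflag // mulr0 subr0 //.
have wi : - Y * w oi 0 = 1.
  by rewrite wE eqxx mulr1n -val_eqE /= ltn_eqF // mulr0n sub0r mulrNN mulrC.
have w0 (l : 'I_k) : (l < i)%N -> w l 0 = 0.
  move=> li; rewrite wE -!val_eqE /= !ltn_eqF ?subr0 //; lia.
have [W [V [N [VW MW [u uw]]]]] := extend_flag low wi w0 cflag.
have [Gs Gn] := submodule_image H VW MW.
have Gw : exists u, kp (ki w) = W *m u by exists u; rewrite (kiK H) uw.
have := uniq _ Gs Gn (ki w) Gw oi1 (leqnn _).
rewrite (kiK H) wE eqxx mulr1n -val_eqE /= gtn_eqF // mulr0n subr0 => b0.
have : (bb : R) 1%N = 0 by rewrite b0 ps0E.
by rewrite bb.unlock => /eqP; rewrite oner_eq0.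
Qed.

Lemma theme_has_form E ls : is_theme E -> fund_inv E ls ->
  exists P Q M, @frame E P Q (natmx (rk E) M) /\ theme_form (rk E) M (nth 0 ls).
Proof.
move=> tE [sz [F [FS _ Ft Fu Fq]]].
have [P [Q [M [fr low diag Ffl]]]] := adapted_basis (fun j jk => (FS j jk).1) Ft Fq.
have H := frame_coords fr; have [c cyc] := theme_cyclic H tE.
have sup0 i : (i.+1 < rk E)%N -> M i i.+1 0%N != 0.
  move=> ik; have ik' := ltnW ik.
  have := cyclic_superdiag _ cyc (i := Ordinal ik') (j := Ordinal ik) erefl.
  rewrite mxE; apply=> s t ts; rewrite mxE; have [E1|ts'] := eqVneq s t.
    by rewrite E1 diag // mulrC bbM0.
  by rewrite low ?ps0E //; move: ts ts'; rewrite -val_eqE /=; lia.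
exists P, Q, M; split=> //; split=> // i ik; apply: (resonance H low diag ik (sup0 i ik)).
move=> G Gs Gn x Gx; apply: Ffl; first exact: ltnW.
exact: (Fu _ _ (ltnW ik) Gs Gn x).1 Gx.
Qed.

(** * Solutions with logarithms *)

(* The coefficient of b^n of the equation [(a - mu b) x = w] in Xi, seen as a
   sequence in the exponent t of log: resonant exactly when [c = 0]. *)
Lemma log_solve (K : fieldType) (c : K) (w : nat -> K) d :
  (forall t, (d <= t)%N -> w t = 0) ->
  exists x : nat -> K, [/\ forall t, c * x t + x t.+1 = w t,
    forall t, (d < t)%N -> x t = 0,
    c != 0 -> forall t, (d <= t)%N -> x t = 0,
    c != 0 -> (forall t, w t = 0) -> forall t, x t = 0
    & c = 0 -> x 0%N = 1].
Proof.
move=> wd; have [->|c0] := eqVneq c 0.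
  (* In the resonant case the degree in log rises by one and x_0 is free; the value 1 starts the
     first solution. *)
  exists (fun t => if t is t'.+1 then w t' else 1); split=> //.
  - by move=> t; rewrite mul0r add0r.
  - by move=> [|t] // dt; apply: wd.
(* Otherwise the recursion runs downwards from x_d = 0, with [y s] standing for x_{d-s}. *)
pose y := fix y s := if s is s'.+1 then (w (d - s)%N - y s') / c else 0.
exists (fun t => y (d - t)%N); split=> //.
- move=> t; case: (leqP d t) => [dt|td].
    have -> : (d - t = 0)%N by lia.
    have -> : (d - t.+1 = 0)%N by lia.
    by rewrite wd // mulr0 addr0.
  have -> : (d - t = (d - t.+1).+1)%N by lia.
  rewrite /= mulrC divfK // subrK; congr w; lia.
- by move=> t dt; have -> : (d - t = 0)%N by lia.
- by move=> _ t dt; have -> : (d - t = 0)%N by lia.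
- move=> _ w0 t; elim: (d - t)%N => //= s ->; by rewrite w0 subr0 mul0r.
by move=> c0'; rewrite c0' eqxx in c0.
Qed.

Section LogSolutions.
Variables (k : nat) (M : nat -> nat -> R) (mu : nat -> rat) (lam : rat) (m : nat -> nat).
Hypothesis gM : theme_form k M mu.
Hypothesis muE : forall i, (i < k)%N -> mu i = lam + (m i)%:R.
Hypothesis m_big : (k.-1 <= m 0)%N.
Hypothesis m_low : forall i, (i < k)%N -> (m 0 <= m i + i)%N.

Let m_res i : (i.+1 < k)%N -> exists p, (m i.+1 + 1 = m i + p)%N /\ M i i.+1 p != 0.
Proof.
move=> ik; have [p [pE Mp]] := g_res gM ik; exists p; split=> //.
move: pE; rewrite !muE ?(ltnW ik) // -!addrA => /addrI /eqP.
by rewrite -[1]/(1%:R) -!natrD eqr_nat => /eqP.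
Qed.

(** [X j t] is the coefficient of e_{lam,t} in the image x_j of the j-th basis vector, and the first
    condition is the equation for a x_j. The exact monomial on the diagonal feeds the next resonance
    and gives independence; the last condition bounds the loss of powers of b. *)
Definition log_solution (X : nat -> nat -> R) j : Prop :=
  [/\ forall t, bb * (ps_d (X j t) + ps_cst (ratr lam) * X j t + X j t.+1)
        = \sum_(i < j) M i j * X i t + M j j * X j t,
      forall t, (j < t)%N -> X j t = 0,
      exists2 c, c != 0 & X j j = ps_cst c * bb ^+ m j
    & forall t n, X j t n != 0 -> (m 0 <= n + j)%N].

Lemma log_solution_eq X X' j : (forall i, (i <= j)%N -> X i = X' i) ->
  log_solution X j -> log_solution X' j.
Proof.
move=> XX'; rewrite /log_solution -(XX' j) // => -[e1 e2 e3 e4]; split=> //.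
move=> t; rewrite e1; congr (_ + _); apply: eq_bigr => i _; rewrite XX' // ltnW //.
Qed.

Lemma log_solution_step X d : (d < k)%N -> (forall j, (j < d)%N -> log_solution X j) ->
  exists Y, log_solution (fun j => if j == d then Y else X j) d.
Proof.
move=> dk IH; pose z t : R := \sum_(i < d) M i d * X i t.
have zd t : (d <= t)%N -> z t = 0.
  move=> dt; rewrite /z big1 // => i _; have [_ XS _ _] := IH i (ltn_ord i).
  by rewrite XS ?mulr0 //; apply: leq_trans dt.
(* The equation is solvable only if its right side is divisible by b. For i < d < k the order of X i
   is at least m_0 - i, which is positive since m_0 >= k - 1. *)
have z0 t : z t 0%N = 0.
  rewrite /z ps_sumE big1 // => i _; have [_ _ _ XO] := IH i (ltn_ord i).
  rewrite psM0; have [->|/XO] := eqVneq (X i t 0%N) 0; first by rewrite mulr0.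
  by have := ltn_ord i; lia.
pose c n : C := n%:R - (m d)%:R.
have cE n : (c n == 0) = (n == m d) by rewrite subr_eq0 eqr_nat.
have [|x xE] := @choice _ _ (fun n (x : nat -> C) =>
  [/\ forall t, c n * x t + x t.+1 = z t n.+1,
    forall t, (d < t)%N -> x t = 0,
    c n != 0 -> forall t, (d <= t)%N -> x t = 0,
    c n != 0 -> (forall t, z t n.+1 = 0) -> forall t, x t = 0
    & c n = 0 -> x 0%N = 1]).
  by move=> n; apply: log_solve => t dt; rewrite zd // ps0E.
pose Y t : R := fun n => x n t; exists Y; rewrite /log_solution eqxx.
have sumE t : \sum_(i < d) M i d * (if (i : nat) == d then Y else X i) t = z t.
  by apply: eq_bigr => i _; rewrite ltn_eqF.
split.
- move=> t; rewrite sumE (g_diag gM) //; apply: funext => -[|n].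
    by rewrite bbM0 psDE z0 -mulrA psM0 bbM0 mulr0 addr0.
  have [e _ _ _ _] := xE n.
  rewrite bbMS !psDE ps_dE -(mulrA (ps_cst _)) 2!ps_cstM bbMS -e /Y /c muE // rmorphD rmorph_nat /=.
  ring.
- by move=> t dt; apply: funext => n; rewrite ps0E; have [_ e _ _ _] := xE n; exact: e.
- have Yd n : n != m d -> Y d n = 0.
    by move=> nm; have [_ _ e _ _] := xE n; apply: e => //; rewrite cE.
  suff Ym : Y d (m d) != 0.
    exists (Y d (m d)) => //; apply: funext => n; rewrite ps_cstM -[bb ^+ _]mulr1 bbXM.
    have [->|nm] := eqVneq n (m d); first by rewrite leqnn subnn ps1E mulr1.
    rewrite Yd //; case: leqP => mn; last by rewrite mulr0.
    by rewrite ps1E subn_eq0 leqNgt ltn_neqAle eq_sym nm mn mulr0.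
  have cm : c (m d) = 0 by rewrite /c subrr.
  have [e _ _ _ e1] := xE (m d).
  have [d0|d0] := posnP d.
    by rewrite /Y [X in x _ X]d0 e1 ?oner_eq0.
  have [d' dE] : exists d', d = d'.+1 by exists d.-1; lia.
  have d'd : (d' < d)%N by rewrite dE.
  (* At the resonance, the coefficient of log^d is that of b^(m_d + 1) in M_{d-1,d} times the
     leading monomial of x_{d-1}. As m_d + 1 = m_{d-1} + p, it is a nonzero multiple of the
     coefficient of b^p. *)
  have := e d'; rewrite cm mul0r add0r -dE -/(Y d (m d)) => ->.
  have d'k : (d'.+1 < k)%N by rewrite -dE.
  have [p [pE Mp]] := m_res d'k; have [_ _ [a a0 aE] _] := IH d' d'd.
  rewrite /z (bigD1 (Ordinal d'd)) //= big1 ?addr0; last first.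
    move=> i id'; have [_ XS _ _] := IH i (ltn_ord i); rewrite XS ?mulr0 //.
    by move: id'; rewrite -val_eqE /=; have := ltn_ord i; lia.
  rewrite aE mulrCA ps_cstM mulrC [M _ _ * _]mulrC bbXM [X in M d' X]dE.
  have -> : ((m d).+1 = m d' + p)%N by rewrite [X in m X]dE; lia.
  by rewrite leq_addr addKn mulf_neq0.
(* Outside the resonance, a nonzero coefficient in degree n comes from some X i with i < d in degree
   at most n + 1: one power of b is lost while the index grows by at least one. *)
move=> t n Yn; have [->|nm] := eqVneq n (m d); first exact: m_low.
have [_ _ _ e _] := xE n; have [H|/existsNP[s zs]] := pselect (forall t, z t n.+1 = 0).
  by move: Yn; rewrite /Y e ?eqxx // cE.
move: zs; rewrite /z ps_sumE => zs.
have [i Mi] : exists i : 'I_d, (M i d * X i s) n.+1 <> 0.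
  by apply/existsNP => H; apply: zs; rewrite big1.
have [j Xj] : exists j : 'I_n.+2, X i s (n.+1 - j)%N <> 0.
  apply/existsNP => H; apply: Mi; rewrite psME big1 // => j _.
  by rewrite H mulr0.
have [_ _ _ XO] := IH i (ltn_ord i); have := XO s (n.+1 - j)%N.
by move=> /(_ (introN eqP Xj)); have := ltn_ord i; have := ltn_ord j; lia.
Qed.

Lemma log_solutions : exists X, forall j, (j < k)%N -> log_solution X j.
Proof.
suff H d : (d <= k)%N -> exists X, forall j, (j < d)%N -> log_solution X j by exact: H.
elim: d => [|d IH] dk; first by exists (fun _ _ => 0).
have [X XE] := IH (ltnW dk); have [Y YE] := log_solution_step dk XE.
exists (fun j => if j == d then Y else X j) => j; rewrite ltnS leq_eqVlt => /orP[/eqP->//|jd].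
apply: (log_solution_eq _ (XE j jd)) => i ij.
by rewrite ltn_eqF //; apply: leq_ltn_trans jd.
Qed.

(** The table [X j t] is triangular, with nonzero multiples of powers of b on its diagonal. *)
Lemma log_solutions_free X : (forall j, (j < k)%N -> log_solution X j) ->
  forall e : 'cV[R]_k, (forall t, \sum_j e j 0 * X j t = 0) -> e = 0.
Proof.
move=> XE e eX; suff H d : (d <= k)%N -> flag d e -> e = 0.
  by apply: (H k) => // i; rewrite leqNgt ltn_ord.
elim: d => [|d IH] dk ed.
  by apply/matrixP => i j; rewrite ord1 ed // mxE.
apply: IH; first exact: ltnW.
move=> i; rewrite leq_eqVlt => /orP[/eqP di|]; last exact: ed.
have <- : Ordinal dk = i by apply: val_inj.
have := eX d; rewrite (bigD1 (Ordinal dk)) //= big1 ?addr0; last first.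
  move=> j jd; have [dj|jd'] := ltnP d j; first by rewrite ed ?mul0r.
  have [_ XS _ _] := XE j (ltn_ord j); rewrite XS ?mulr0 //.
  by move: jd; rewrite -val_eqE /=; lia.
have [_ _ [c c0 ->] _] := XE d dk; rewrite mulrC -mulrA => E.
apply: (@bbX_inj _ (m d)); rewrite mulr0.
apply: funext => n; have := congr1 (fun S : R => S n) E.
by rewrite ps0E ps_cstM => /eqP; rewrite mulf_eq0 (negPf c0) => /eqP.
Qed.

End LogSolutions.

(** As the interval is open at 0 and closed at 1, m is the ceiling of x minus one. *)
Lemma rat_in01 (x : rat) (k : nat) : k%:R < x ->
  exists lam (m : nat), [/\ 0 < lam <= 1, x = lam + m%:R & (k <= m)%N].
Proof.
move=> kx; have x0 : 0 <= x by apply: le_trans (ltW kx); apply: ler0n.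
have ex : exists n, (fun n => x <= n.+1%:R) n.
  exists (Num.bound x); apply: le_trans (ltW (archi_boundP x0)) _.
  by rewrite ler_nat.
case: (ex_minnP ex) => m xm mmin; exists (x - m%:R), m; split.
- apply/andP; split; last by rewrite lerBlDr addrC -natr1 addrC in xm *.
  rewrite subr_gt0; case: m xm mmin => [|m] xm mmin; first exact: le_lt_trans (ler0n _ k) kx.
  by rewrite ltNge; apply/negP => /mmin; rewrite ltnn.
- by rewrite subrK.
by have := lt_le_trans kx xm; rewrite ltr_nat ltnS.
Qed.

(** From m_{i+1} + 1 = m_i + p with p a natural number, the exponents drop by at most one per step;
    starting from m_0 >= k - 1 they remain natural numbers. *)
Lemma exponents k (M : nat -> nat -> R) mu : theme_form k M mu -> (0 < k)%N -> k%:R - 1 < mu 0%N ->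
  exists (lam : rat) (m : nat -> nat), [/\ 0 < lam <= 1,
    forall i, (i < k)%N -> mu i = lam + (m i)%:R, (k.-1 <= m 0)%N
    & forall i, (i < k)%N -> (m 0 <= m i + i)%N].
Proof.
move=> gM k0 mu0; have kE : k%:R - 1 = k.-1%:R :> rat.
  by rewrite -{1}(prednK k0) -natr1 addrK.
rewrite kE in mu0; have [lam [m0 [lam01 muE0 km0]]] := rat_in01 mu0.
have mi i : exists mi : nat, (i < k)%N -> mu i = lam + mi%:R /\ (m0 <= mi + i)%N.
  elim: i => [|i [mi IH]]; first by exists m0; rewrite addn0.
  have [ik|] := ltnP i.+1 k; last by exists 0%N; lia.
  have [muE mim] := IH (ltnW ik); have [p [pE _]] := g_res gM ik.
  exists (mi + p).-1 => _; have mi0 : (0 < mi)%N by lia.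
  split; last by lia.
  have mpE : (mi + p)%:R = (mi + p).-1%:R + 1 :> rat by rewrite natr1 prednK //; lia.
  have : mu i.+1 + 1 = lam + ((mi + p).-1%:R + 1).
    by rewrite pE muE -addrA -natrD mpE.
  by rewrite addrA => /addIr.
have [m mE] := choice mi.
have m00 : m 0%N = m0.
  have [muE _] := mE 0%N k0; have := muE; rewrite muE0 => /addrI /eqP.
  by rewrite eqr_nat => /eqP ->.
exists lam, m; split=> //; rewrite ?m00 // => i ik; by have [] := mE i ik.
Qed.

Lemma xa_leibniz (b c x y l : R) :
  c * (b * (ps_d x + l * x + y)) + b * (ps_d c * x) =
  b * (ps_d (c * x) + l * (c * x) + c * y).
Proof. by rewrite ps_dM; ring. Qed.

Lemma theme_form_is_theme E (M : nat -> nat -> R) mu kp ki :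
  coords (natmx (rk E) M) kp ki -> theme_form (rk E) M mu ->
  ((0 < rk E)%N -> (rk E)%:R - 1 < mu 0%N) -> is_theme E.
Proof.
move=> H gM mu0; set k := rk E in gM mu0 *.
have [lam [m [lam01 muE mbig mlow]]] : exists (lam : rat) (m : nat -> nat), [/\ 0 < lam <= 1,
    forall i, (i < k)%N -> mu i = lam + (m i)%:R, (k.-1 <= m 0)%N
    & forall i, (i < k)%N -> (m 0 <= m i + i)%N].
  have [k0|k0] := posnP k; last exact: exponents gM k0 (mu0 k0).
  by exists 1, (fun _ => 0%N); rewrite k0.
have [X XE] := log_solutions gM muE mbig mlow.
pose g (c : 'cV[R]_k) t : R := \sum_j c j 0 * X j t.
pose f (x : vec k) : xi := fun l t => if l == lam then g (kp x) t else (0 : R).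
have fE x l t : (f x l t : R) = if l == lam then g (kp x) t else 0 by [].
have fD x y : f (vadd x y) = xadd (f x) (f y).
  do 2!apply: funext => ?; rewrite -[RHS]/(_ : R) xaddE !fE (kpD H).
  case: ifP => _; last by rewrite addr0.
  by rewrite /g -big_split; apply: eq_bigr => j _; rewrite mxE mulrDl.
have fZ S x : f (vscal S x) = xscal S (f x).
  do 2!apply: funext => ?; rewrite -[RHS]/(_ : R) xscalE !fE (kpZ H).
  case: ifP => _; last by rewrite mulr0.
  by rewrite /g mulr_sumr; apply: eq_bigr => j _; rewrite mxE mulrA.
have fa x : f (aact E x) = xa (f x).
  apply: funext => l; apply: funext => t; rewrite -[RHS]/(_ : R) xaE !fE (kpa H).
  case: eqP => [->|_]; last by rewrite raddf0 mulr0 !addr0 mulr0.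
  rewrite /g; set c := kp x.
  (* The double sum is regrouped by columns, so that the equation of each x_j applies. *)
  transitivity (\sum_j (c j 0 * (\sum_(i < k) M i j * X i t) + bb * (ps_d (c j 0) * X j t))).
    under eq_bigr => j _ do rewrite actE mulrDl mulr_suml.
    rewrite big_split /= exchange_big /= big_split /=; apply: congr2.
      apply: eq_bigr => j _; rewrite mulr_sumr; apply: eq_bigr => i _.
      by rewrite mxE mulrAC mulrC mulrA.
    by apply: eq_bigr => j _; rewrite mulrA.
  rewrite raddf_sum mulr_sumr -!big_split mulr_sumr; apply: eq_bigr => j _ /=.
  have [XA _ _ _] := XE j (ltn_ord j).
  have -> : \sum_(i < k) M i j * X i t = bb * (ps_d (X j t) + ps_cst (ratr lam) * X j t + X j t.+1).
    rewrite XA (big_ord_widen k (fun i => M i j * X i t) (ltnW (ltn_ord j))).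
    rewrite [X in _ = X + _]big_mkcond (bigD1 j) //= [in RHS](bigD1 j) //= ltnn add0r addrC.
    apply: congr2 => //; apply: eq_bigr => i ij; case: ltnP => // ji.
    rewrite (g_low gM) ?mul0r //; move: ij; rewrite -val_eqE /= => ij.
    by rewrite ltn_neqAle ji andbT eq_sym.
  exact: xa_leibniz.
have finj : injective f.
  move=> x y /(congr1 (fun h => h lam)) fxy; apply: (ki_ext H); apply/eqP.
  rewrite -subr_eq0; apply/eqP; apply: (log_solutions_free mbig XE) => t.
  have := congr1 (fun h => h t) fxy; rewrite -[LHS]/(f x lam t : R) -[RHS]/(f y lam t : R).
  rewrite !fE eqxx /g => gxy.
  under eq_bigr => j _ do rewrite 2!mxE mulrBl.
  by rewrite sumrB gxy subrr.
have fXi x : in_Xi (f x).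
  exists [:: lam], k => l t n fx; have ll : l = lam.
    by apply/eqP; apply: contraNT fx => /negPf ll; rewrite -[f _ _ _]/(f x l t : R) fE ll ps0E.
  split; rewrite ?ll ?inE //; rewrite ltnNge; apply: contraNN fx => kt.
  rewrite -[f _ _ _]/(f x l t : R) fE ll eqxx /g big1 ?ps0E // => j _.
  have [_ XS _ _] := XE j (ltn_ord j); rewrite XS ?mulr0 //.
  exact: leq_trans (ltn_ord j) kt.
have Mlow (i j : 'I_k) : (j <= i)%N -> natmx k M i j 0%N = 0.
  rewrite mxE leq_eqVlt => /orP[/eqP ->|ji]; last by rewrite (g_low gM) ?ps0E.
  by rewrite (g_diag gM) // mulrC bbM0.
have [|c cyc] := superdiag_cyclic Mlow.
  move=> i j ji; have := ltn_ord j; rewrite ji mxE ji => ik; exact: g_sup0 gM _ ik.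
exact: (cyclic_is_theme H fD fZ fa (fXi (ki c)) finj cyc).
Qed.

(** * Saturation and Bernstein polynomial *)

Lemma poly_ideal_generator (F : fieldType) (I : {poly F} -> Prop) :
  (forall P Q, I P -> I Q -> I (P + Q)) -> (forall P Q, I Q -> I (P * Q)) ->
  (exists2 Q, I Q & Q != 0) ->
  exists B, [/\ B \is monic, I B & forall Q, I Q -> B %| Q].
Proof.
move=> ID IM [Q0 IQ0 Q00].
have ex : exists n, (fun n => `[< exists Q, [/\ I Q, Q != 0 & size Q = n] >]) n.
  by exists (size Q0); apply/asboolP; exists Q0.
case: (ex_minnP ex) => n /asboolP[B [IB B0 sB]] nmin.
have lB : (lead_coef B)^-1 != 0 by rewrite invr_eq0 lead_coef_eq0.
exists ((lead_coef B)^-1 *: B); split.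
- by rewrite monicE lead_coefZ mulVf // lead_coef_eq0.
- by rewrite -mul_polyC; apply: IM.
move=> Q IQ; rewrite dvdpZl // /dvdp; apply: contraT => QB0.
have : (n <= size (Q %% B)%R)%N.
  apply: nmin; apply/asboolP; exists (Q %% B); split=> //.
  have -> : Q %% B = Q + - (Q %/ B) * B by rewrite mulNr {2}(divp_eq Q B) addrAC subrr add0r.
  by apply: ID => //; apply: IM.
by rewrite leqNgt -sB ltn_modp B0.
Qed.

Lemma cstE c : cst c = ps_cst c :> R.
Proof. by rewrite ps_cst.unlock. Qed.

Lemma scale_bbX_inj k n : injective (fun u : 'cV[R]_k => bb ^+ n *: u).
Proof.
move=> u v E; apply/matrixP => i j; have := congr1 (fun w : 'cV_k => w i j) E.
by rewrite !mxE; apply: bbX_inj.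
Qed.

Section LaurentValues.
Variable k : nat.
Implicit Types p q : lrep k.

Lemma lval_cf p s m : lval p (m%:Z - (p.1 + s)%:Z) = cf m (bb ^+ s *: tomx p.2).
Proof.
rewrite cf_bbX cf_tomx /lval; case: leqP => sm.
  by have -> : (m%:Z - (p.1 + s)%:Z + p.1%:Z = (m - s)%N%:Z)%R by lia.
by case E : (m%:Z - (p.1 + s)%:Z + p.1%:Z)%R => [n|n] //; lia.
Qed.

Lemma lval_eq p q : lval p = lval q <-> bb ^+ q.1 *: tomx p.2 = bb ^+ p.1 *: tomx q.2.
Proof.
split=> [E|E].
  by apply: cfP => m; rewrite -!lval_cf E addnC.
apply: funext => z; have [zl|zl] := leP (- (p.1 + q.1)%:Z)%R z.
  have -> : z = ((absz (z + (p.1 + q.1)%:Z))%:Z - (p.1 + q.1)%:Z)%R by lia.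
  by rewrite lval_cf E addnC lval_cf.
rewrite /lval; case E1 : (z + p.1%:Z)%R => [n|n]; first by lia.
by case E2 : (z + q.1%:Z)%R => [n'|n'] //; lia.
Qed.

End LaurentValues.

Section Theta.
Variables (k : nat) (N : 'M[R]_k).

(* The operator -b^-1 a on a lattice stable by b^-1 a. *)
Definition minus_binva (y : 'cV[R]_k) : 'cV[R]_k := - (N *m y + dm y).
Fact minus_binva_additive : zmod_morphism minus_binva.
Proof. by move=> u v; rewrite /minus_binva mulmxBr /dm map_mxB [in LHS]addrACA -[in LHS]opprD [LHS]opprB [in RHS]opprK [LHS]addrC. Qed.
HB.instance Definition _ := GRing.isZmodMorphism.Build 'cV[R]_k 'cV[R]_k minus_binva minus_binva_additive.

Lemma minus_binvaE y i : minus_binva y i 0 = - (\sum_j N i j * y j 0 + ps_d (y i 0)).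
Proof. by rewrite !mxE. Qed.

Lemma minus_binvaZ S y : minus_binva (S *: y) = S *: minus_binva y - ps_d S *: y.
Proof.
apply/matrixP => i j; rewrite ord1 minus_binvaE [RHS]mxE [X in _ = X + _]mxE minus_binvaE.
have -> : (- (ps_d S *: y)) i 0 = - (ps_d S * y i 0) by rewrite !mxE.
have -> : ps_d ((S *: y) i 0) = ps_d S * y i 0 + S * ps_d (y i 0) by rewrite mxE ps_dM.
have -> : \sum_j0 N i j0 * (S *: y) j0 0 = S * \sum_j0 N i j0 * y j0 0.
  by rewrite mulr_sumr; apply: eq_bigr => l _; rewrite mxE mulrCA.
by move: (\sum_j0 _) => z; ring.
Qed.

Lemma minus_binva_cst c y : minus_binva (ps_cst c *: y) = ps_cst c *: minus_binva y.
Proof. by rewrite minus_binvaZ ps_d_cst scale0r subr0. Qed.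

Lemma polop_eigen P c y : minus_binva y = ps_cst c *: y ->
  polop minus_binva P y = ps_cst P.[c] *: y.
Proof.
move=> yc; elim/poly_ind: P => [|P e IH].
  by rewrite (@polopE _ _ _ 0 0) ?size_poly0 // big_ord0 horner0 rmorph0 scale0r.
rewrite polop_cons /= yc (polopZr minus_binva_cst) IH scalerA -scalerDl.
by rewrite -rmorphM -rmorphD /= hornerMXaddC mulrC.
Qed.

End Theta.

Section Bernstein.
Variables (E : abmod) (M : nat -> nat -> R) (mu : nat -> rat).
Variables (kp : vec (rk E) -> 'cV[R]_(rk E)) (ki : 'cV[R]_(rk E) -> vec (rk E)).
Hypothesis H : coords (natmx (rk E) M) kp ki.
Hypothesis gM : theme_form (rk E) M mu.
Local Notation k := (rk E).

Let h (i : nat) : nat := (k.-1 - i)%N.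

(* Coordinates in the lattice spanned by the [b^-(k-1-i) e_i], which contains E and
   is stable by b^-1 a. *)
Definition sat_coord (x : vec k) : 'cV[R]_k := \col_i (bb ^+ h i * kp x i 0).
Lemma sat_coordE x i : sat_coord x i 0 = bb ^+ h i * kp x i 0. Proof. by rewrite mxE. Qed.

(** Matrix of b^{-1}a in the basis b^{-h_i} e_i. The weights turn M_ij / b into b^(j-i-1) M_ij,
    without a pole for i < j, and lower the diagonal exponents by h_i. *)
Definition satM : 'M[R]_k := \matrix_(i, j)
  if i == j then ps_cst (ratr (mu i - (h i)%:R))
  else if (i < j)%N then bb ^+ (j - i).-1 * M i j else 0.
Local Notation T := (minus_binva satM).

Lemma sat_coordD x y : sat_coord (vadd x y) = sat_coord x + sat_coord y.
Proof. by apply/matrixP => i j; rewrite !mxE (kpD H) mxE mulrDr. Qed.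
Lemma sat_coordZ S x : sat_coord (vscal S x) = (S : R) *: sat_coord x.
Proof. by apply/matrixP => i j; rewrite !mxE (kpZ H) mxE mulrCA. Qed.
Lemma sat_coord_b x : sat_coord (vb x) = bb *: sat_coord x.
Proof. by apply/matrixP => i j; rewrite !mxE (kpb H) mxE mulrCA. Qed.
Lemma sat_coord_bn n x : sat_coord (iter n (@vb k) x) = bb ^+ n *: sat_coord x.
Proof.
by elim: n => [|n IH]; rewrite ?scale1r // iterS sat_coord_b IH scalerA -exprS.
Qed.
Lemma sat_coord_inj : injective sat_coord.
Proof.
move=> x y xy; apply: (ki_ext H); apply/matrixP => i j; rewrite ord1.
by have := congr1 (fun u : 'cV_k => u i 0) xy; rewrite !sat_coordE => /bbX_inj.
Qed.
Lemma sat_coord_a x : sat_coord (aact E x) = - (bb *: T (sat_coord x)).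
Proof.
apply/matrixP => i j; rewrite ord1 sat_coordE (kpa H) actE.
have -> : (- (bb *: T (sat_coord x))) i 0 = - (bb * T (sat_coord x) i 0) by rewrite !mxE.
rewrite minus_binvaE mulrN opprK sat_coordE ps_dM ps_d_bbX mulrDr mulr_sumr.
rewrite (bigD1 i) //= [in RHS](bigD1 i) //= !mxE eqxx (g_diag gM) //.
rewrite !mulrDr mulr_sumr.
have -> : \sum_(l < k | l != i) bb ^+ h i * (natmx k M i l * kp x l 0) =
    \sum_(l < k | l != i) bb * (satM i l * sat_coord x l 0).
  apply: eq_bigr => l li; rewrite sat_coordE !mxE eq_sym (negPf li).
  case: ltnP => [il|il]; last by rewrite (g_low gM) ?mul0r ?mulr0 // ltn_neqAle il andbT.
  have -> : h i = ((l - i).-1 + h l).+1 by rewrite /h; have := ltn_ord l; lia.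
  by rewrite exprS exprD; ring.
move: (\sum_(l < k | l != i) _) => z.
by rewrite rmorphB rmorphB /= !rmorph_nat; ring.
Qed.

(** The Laurent element b^{-N} x coded by [p] lies in the lattice, with coordinates y; the
    denominator is cleared to stay within power series. *)
Definition rep (p : lrep k) (y : 'cV[R]_k) := sat_coord p.2 = bb ^+ p.1 *: y.

Lemma lval_sat_coord p q : lval p = lval q <-> bb ^+ q.1 *: sat_coord p.2 = bb ^+ p.1 *: sat_coord q.2.
Proof.
rewrite lval_eq -!sat_coordZ -!tomxZ.
by split=> [/(can_inj (@tomxK _)) ->|/sat_coord_inj ->].
Qed.

Lemma rep_eq p q y : lval p = lval q -> rep p y -> rep q y.
Proof.
rewrite /rep => /lval_sat_coord pq py; apply: (@scale_bbX_inj _ p.1).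
by rewrite /= -pq py !scalerA mulrC.
Qed.
Lemma rep_lval p q y : rep p y -> rep q y -> lval p = lval q.
Proof. by rewrite /rep => py qy; apply/lval_sat_coord; rewrite py qy !scalerA mulrC. Qed.
Lemma rep_inj p y z : rep p y -> rep p z -> y = z.
Proof. by rewrite /rep => -> /scale_bbX_inj. Qed.

Lemma rep_add p q y z : rep p y -> rep q z -> rep (ladd p q) (y + z).
Proof.
rewrite /rep /= => py qz; rewrite sat_coordD !sat_coord_bn py qz !scalerA -!exprD scalerDr.
by rewrite addnC.
Qed.
Lemma rep_scal S p y : rep p y -> rep (lscal S p) ((S : R) *: y).
Proof. by rewrite /rep /= sat_coordZ => ->; rewrite !scalerA mulrC. Qed.
Lemma rep_b p y : rep p y -> rep (lb p) (bb *: y).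
Proof. by rewrite /rep /= sat_coord_b => ->; rewrite !scalerA mulrC. Qed.
Lemma rep_T p y : rep p y -> rep (lT E p) (- T y).
Proof.
rewrite /rep /= sat_coordD sat_coordZ sat_coord_b sat_coord_a cstE => ->.
rewrite minus_binvaZ ps_d_bbX exprS rmorphN rmorph_nat /=.
by apply/matrixP => i j; rewrite !mxE; ring.
Qed.

Definition Sat y := exists2 p, sat E (lval p) & rep p y.

(** The lattice contains E and is stable under all the operations generating the saturation, hence
    contains it. *)
Lemma sat_rep X : sat E X -> forall p, X = lval p -> exists y, rep p y.
Proof.
elim=> [x|p q _ IHp _ IHq|S p _ IH|p _ IH] r E'.
- by exists (sat_coord x); apply: rep_eq E' _; rewrite /rep scale1r.
- have [[y py] [z qz]] := (IHp p erefl, IHq q erefl).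
  by exists (y + z); apply: rep_eq E' _; apply: rep_add.
- have [y py] := IH p erefl; exists ((S : R) *: y); apply: rep_eq E' _; exact: rep_scal.
have [y py] := IH p erefl; exists (- T y); apply: rep_eq E' _; exact: rep_T.
Qed.

Lemma Sat_coord x : Sat (sat_coord x).
Proof. by exists (0%N, x); [exact: sat_E | rewrite /rep scale1r]. Qed.
Lemma SatD y z : Sat y -> Sat z -> Sat (y + z).
Proof. by move=> [p sp py] [q sq qz]; exists (ladd p q); [exact: sat_add|exact: rep_add]. Qed.
Lemma SatZ S y : Sat y -> Sat (S *: y).
Proof. by move=> [p sp py]; exists (lscal S p); [exact: sat_scal|exact: rep_scal]. Qed.
Lemma SatT y : Sat y -> Sat (T y).
Proof.
move=> [p sp py]; rewrite -[T y]opprK -scaleN1r; apply: SatZ.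
by exists (lT E p); [exact: sat_T|exact: rep_T].
Qed.
Lemma Sat_polop P y : Sat y -> Sat (polop T P y).
Proof.
move=> Sy; elim/poly_ind: P y Sy => [|P c IH] y Sy.
  rewrite (@polopE _ _ _ 0 0) ?size_poly0 // big_ord0 -(scale0r y); exact: SatZ.
by rewrite polop_cons; apply: SatD; [apply: IH; exact: SatT | exact: SatZ].
Qed.

Lemma rep_lpoly Q p y : rep p y -> rep (lpoly E Q p) (polop T Q y).
Proof.
move=> py.
have ri i : rep (iter i (fun r => lscal (cst (-1)) (lT E r)) p) (iter i T y).
  elim: i => // i IH; rewrite !iterS.
  have -> : T (iter i T y) = (cst (-1) : R) *: (- T (iter i T y)).
    by rewrite cstE rmorphN1 scaleN1r opprK.
  by apply: rep_scal; apply: rep_T.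
have -> : polop T Q y = \sum_(i <- iota 0 (size Q)) ps_cst Q`_i *: iter i T y.
  by rewrite polop.unlock -(big_mkord xpredT (fun i => ps_cst Q`_i *: iter i T y))
      /index_iota subn0.
rewrite /lpoly; elim: (iota 0 _) => [|i s IH] /=.
  rewrite big_nil /rep /= scaler0; apply/matrixP => i j.
  by rewrite ord1 sat_coordE (kp0 H) !mxE mulr0.
by rewrite big_cons; apply: rep_add => //; rewrite -cstE; apply: rep_scal.
Qed.

Lemma kills_Sat Q : kills E Q <->
  forall y, Sat y -> exists2 z, Sat z & polop T Q y = bb *: z.
Proof.
split=> [kQ y [p sp py]|kQ p sp].
  have [q sq E'] := kQ p sp; have [z qz] := sat_rep sq erefl.
  exists z; first by exists q.
  apply: (rep_inj (rep_eq E' (rep_lpoly Q py))); exact: rep_b.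
have [y py] := sat_rep sp erefl; have [|z [q sq qz] E'] := kQ y; first by exists p.
exists q => //; apply: rep_lval (rep_lpoly Q py) _; rewrite E'; exact: rep_b.
Qed.

(** Multiplication by b^(k-1) clears every denominator of the lattice, so it maps the lattice into
    E. *)
Lemma sat_coord_surj y : exists x, sat_coord x = bb ^+ k.-1 *: y.
Proof.
exists (ki (\col_i (bb ^+ i * y i 0))); apply/matrixP => i j.
rewrite ord1 sat_coordE (kiK H) !mxE mulrA -exprD; congr (bb ^+ _ * _).
by rewrite /h; have := ltn_ord i; lia.
Qed.

Lemma theme_form_regular : regular E.
Proof.
pose E' := ABMod (ofAmx (bb *: satM)).
have E'a (y : 'cV[R]_k) : act (Amx E') y = - (bb *: T y).
  rewrite Amx_of; apply/matrixP => i j; rewrite ord1 actE !mxE mulrN opprK mulrDr mulr_sumr.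
  by congr (_ + _); apply: eq_bigr => l _; rewrite mxE mulrA.
exists E', (fun x => ofmx (sat_coord x)); split.
- split.
  + by move=> x y; apply: (can_inj (@tomxK _)); rewrite tomxD !ofmxK sat_coordD.
  + by move=> S x; apply: (can_inj (@tomxK _)); rewrite tomxZ !ofmxK sat_coordZ.
  by move=> x; apply: (can_inj (@tomxK _)); rewrite (@tomx_a E') !ofmxK E'a sat_coord_a.
- by move=> x y /(can_inj (@ofmxK _)) /sat_coord_inj.
move=> y; exists (ofmx (- T (tomx y))); apply: (can_inj (@tomxK _)).
rewrite (@tomx_a E') tomx_b ofmxK [RHS]scalerN; exact: E'a.
Qed.

(** The first lattice vector d is an eigenvector. For the least m with b^m d in the saturation, b^m
    d is not b times an element of it, so its eigenvalue has to be a root of B. *)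
Lemma bernstein_root_invariant B (k0 : (0 < k)%N) : bernstein E B ->
  exists m : nat, root B (- ratr (mu 0%N - (k.-1)%:R + m%:R)).
Proof.
move=> [_ /kills_Sat kB _]; pose i0 := Ordinal k0; pose d : 'cV[R]_k := delta_mx i0 0.
have Sd : exists m, (fun m => `[< Sat (bb ^+ m *: d) >]) m.
  by exists k.-1; apply/asboolP; have [x <-] := sat_coord_surj d; exact: Sat_coord.
case: (ex_minnP Sd) => m /asboolP Sm mmin; exists m.
pose c : C := - ratr (mu 0%N - (k.-1)%:R + m%:R).
have Td : T d = ps_cst (- ratr (mu 0%N - (k.-1)%:R)) *: d.
  apply/matrixP => i j; rewrite ord1 minus_binvaE (bigD1 i0) //= big1 ?addr0; last first.
    by move=> l /negPf l0; rewrite [d _ _]mxE l0 mulr0.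
  have -> : ps_d (d i 0) = 0 by rewrite mxE; case: (_ && _); rewrite ?ps_d1 ?raddf0.
  have -> : (ps_cst (- ratr (mu 0%N - (k.-1)%:R)) *: d) i 0 =
      ps_cst (- ratr (mu 0%N - (k.-1)%:R)) * (i == i0)%:R by rewrite !mxE andbT.
  have -> : d i0 0 = 1 by rewrite mxE !eqxx.
  rewrite mulr1 addr0 mxE; have [->|i0'] := eqVneq i i0.
    by rewrite /h subn0 mulr1 rmorphN.
  by rewrite ltn0 mulr0 oppr0.
have Tc : T (bb ^+ m *: d) = ps_cst c *: (bb ^+ m *: d).
  rewrite minus_binvaZ ps_d_bbX Td !scalerA -scalerBl; congr (_ *: _).
  by rewrite /c rmorphD /= opprD rmorphD !rmorphN /= !rmorph_nat; ring.
have [z Sz] := kB _ Sm; rewrite (polop_eigen _ Tc) => zE.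
apply: contraT; rewrite /root -/c => Bc.
have E1 : bb ^+ m *: d = bb *: (ps_cst (B.[c])^-1 *: z).
  by rewrite scalerA mulrC -scalerA -zE !scalerA -rmorphM /= mulVf // rmorph1 mul1r.
(* If B did not vanish at c, b^m d would be b times an element of the saturation: impossible for m =
   0 as d is nonzero modulo b, and contrary to minimality for m > 0. *)
case: m mmin Sm @c Tc zE Bc E1 => [|m] mmin Sm c Tc zE Bc E1.
  have := congr1 (fun u : 'cV_k => u i0 0 0%N) E1.
  by rewrite scale1r !mxE !eqxx /= mulr1n ps1E bbM0 => /eqP; rewrite oner_eq0.
suff /mmin : `[< Sat (bb ^+ m *: d) >] by rewrite ltnn.
apply/asboolP; move: E1; rewrite exprS -scalerA => /scale_bb_inj ->.
exact: SatZ.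
Qed.

(** A filtration of the lattice refining the b-adic one by the flag; [vanish n 0] means divisibility
    by b^(n+1). *)
Definition vanish n j (y : 'cV[R]_k) : Prop :=
  (forall m i, (m < n)%N -> y i 0 m = 0) /\ (forall i : 'I_k, (j <= i)%N -> y i 0 n = 0).

(** By triangularity, -b^{-1}a acts on this graded piece as the scalar -(mu_j - h_j + n), which the
    linear factor annihilates. *)
Lemma vanish_step n (j : 'I_k) y : vanish n j.+1 y ->
  vanish n j (polop T ('X - (- ratr (mu j - (h j)%:R + n%:R))%:P) y).
Proof.
move=> [yn yj].
have Tm m i : (m <= n)%N -> (T y) i 0 m = - (\sum_l satM i l 0%N * y l 0 m + m%:R * y i 0 m).
  move=> mn; rewrite minus_binvaE psNE psDE ps_dE ps_sumE; congr (- (_ + _)).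
  apply: eq_bigr => l _; rewrite psME big_ord_recl subn0 big1 ?addr0 // => t _.
  by rewrite yn ?mulr0 //= /bump /=; have := ltn_ord t; lia.
have PE : polop T ('X - (- ratr (mu j - (h j)%:R + n%:R))%:P) y
    = T y + ps_cst (ratr (mu j - (h j)%:R + n%:R)) *: y.
  by rewrite -polyCN opprK -['X]mul1r -polyC1 polop_cons polopC rmorph1 scale1r.
rewrite PE; split=> [m i mn|i ji].
  rewrite mxE psDE [X in _ + X _]mxE ps_cstM (yn m i mn) mulr0 addr0 Tm ?(ltnW mn) //.
  by rewrite big1 ?(yn m i mn) ?mulr0 ?addr0 ?oppr0 // => l _; rewrite yn ?mulr0.
rewrite mxE psDE [X in _ + X _]mxE ps_cstM Tm //.
rewrite (bigD1 i) //= big1 ?addr0; last first.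
  move=> l li; have [il|il] := ltnP i l; first by rewrite yj ?mulr0 //; apply: leq_ltn_trans il.
  by rewrite mxE eq_sym (negPf li) ltnNge il /= ps0E mul0r.
move: ji; rewrite leq_eqVlt => /orP[/eqP ji|ji]; last by rewrite yj // !(mulr0, addr0, oppr0).
have -> : i = j by apply: val_inj.
rewrite mxE eqxx ps_cstE /= !rmorphD /= !rmorph_nat; ring.
Qed.

(** * A polynomial killing the saturation modulo b, and its roots *)

Section KillingPolynomial.
Variable lam : rat.
Hypothesis mulam : forall i, (i < k)%N -> exists m : int, mu i = lam + m%:~R.

Let goodp (Q : {poly C}) : Prop :=
  Q != 0 /\ forall z, root Q z -> exists m : int, z = ratr (- lam) + m%:~R.

Let goodpM P Q : goodp P -> goodp Q -> goodp (P * Q).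
Proof.
move=> [P0 Pr] [Q0 Qr]; split=> [|z]; first by rewrite mulf_neq0.
by rewrite rootM => /orP[/Pr|/Qr].
Qed.

Let goodp1 : goodp 1.
Proof. by split=> [|z]; rewrite ?oner_neq0 // -polyC1 rootC oner_eq0. Qed.

Let vanish_row n j : (j <= k)%N ->
  exists2 Q, goodp Q & forall y, vanish n j y -> vanish n 0 (polop T Q y).
Proof.
elim: j => [|j IH] jk.
  exists 1; first exact: goodp1.
  by move=> y; rewrite -polyC1 polopC rmorph1 scale1r.
have [Q gQ QE] := IH (ltnW jk); pose oj := Ordinal jk.
exists (Q * ('X - (- ratr (mu j - (h j)%:R + n%:R))%:P)).
  apply: goodpM => //; split=> [|z]; first by rewrite polyXsubC_eq0.
  rewrite root_XsubC => /eqP ->; have [m ->] := mulam jk.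
  exists ((h j)%:Z - n%:Z - m); rewrite -rmorphN -ratr_int -rmorphD; congr ratr.
  by rewrite !rmorphB /= !pmulrn; ring.
by move=> y yv; rewrite (polopM (@minus_binva_cst _ _)); apply: QE; exact: (@vanish_step n oj).
Qed.

Let vanish_rows n : exists2 Q, goodp Q & forall y, vanish n 0 (polop T Q y).
Proof.
elim: n => [|n [P gP PE]].
  have [Q gQ QE] := vanish_row 0 (leqnn k); exists Q => // y; apply: QE.
  by split=> // i; rewrite leqNgt ltn_ord.
have [Q gQ QE] := vanish_row n.+1 (leqnn k); exists (Q * P); first exact: goodpM.
move=> y; rewrite (polopM (@minus_binva_cst _ _)); apply: QE; have [Pn P0] := PE y.
split=> [m i|i]; last by rewrite leqNgt ltn_ord.
by rewrite ltnS leq_eqVlt => /orP[/eqP ->|/Pn]; [exact: P0|apply].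
Qed.

Lemma theme_form_primitive : primitive E lam.
Proof.
split; first exact: theme_form_regular.
(* With n = k - 1, Q0 sends the lattice into its multiple by b^k, which lies in b E and thus in b
   times the saturation. *)
have [Q0 [Q00 Q0r] Q0E] := vanish_rows k.-1.
have kQ0 : kills E Q0.
  apply/kills_Sat => y Sy; have [v1 v2] := Q0E y.
  have [|v vE] := @bbX_divides _ _ k.-1.+1 (polop T Q0 y).
    move=> m; rewrite ltnS leq_eqVlt => mk; apply/matrixP => i j; rewrite ord1 cfE [RHS]mxE.
    by case/orP: mk => [/eqP ->|mk]; [exact: v2 | exact: v1].
  have [x xE] := sat_coord_surj v; exists (sat_coord x); first exact: Sat_coord.
  by rewrite vE xE scalerA -exprS.
have [||B [Bm kB Bd]] := @poly_ideal_generator _ (kills E) _ _ (ex_intro2 _ _ Q0 kQ0 Q00).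
- move=> P Q /kills_Sat kP /kills_Sat kQ; apply/kills_Sat => y Sy.
  have [[z Sz zE] [z' Sz' z'E]] := (kP y Sy, kQ y Sy).
  exists (z + z'); first exact: SatD.
  by rewrite polopDl zE z'E scalerDr.
- move=> P Q /kills_Sat kQ; apply/kills_Sat => y Sy; rewrite mulrC.
  rewrite (polopM (@minus_binva_cst _ _)); apply: kQ; exact: Sat_polop.
exists B; split=> [|z Bz]; first by split.
(* The generator divides Q0, so its roots are among those already located. *)
by apply: Q0r; have /dvdpP[q ->] := Bd _ kQ0; rewrite rootM Bz orbT.
Qed.

End KillingPolynomial.

End Bernstein.

(** * Duality *)

(** One root of the Bernstein polynomial fixes the class of the first invariant modulo Z;
    consecutive invariants differ by the integer p - 1. *)
Lemma invariants_congruent (E : abmod) (M : nat -> nat -> psr C) (mu : nat -> rat) kp ki (lam : rat) :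
  coords (natmx (rk E) M) kp ki -> theme_form (rk E) M mu -> primitive E lam ->
  forall i, (i < rk E)%N -> exists m : int, mu i = lam + m%:~R.
Proof.
move=> H gM [_ [B [bB Br]]]; elim=> [|i IH] ik.
  have [m /Br [m' mE]] := bernstein_root_invariant H gM ik bB.
  exists ((rk E).-1%:Z - m%:Z - m').
  have : mu 0%N - (rk E).-1%:R + m%:R = lam - m'%:~R.
    apply: (fmorph_inj (ratr : {rmorphism rat -> C})); apply: oppr_inj.
    by rewrite mE rmorphB /= ratr_int rmorphN opprB addrC.
  by move/(canRL (addrK _))/(canRL (subrK _)) => ->; rewrite !rmorphB /= -!pmulrn; ring.
have [m mE] := IH (ltnW ik); have [p [pE _]] := g_res gM ik.
exists (m + p%:Z - 1); move/(canRL (addrK _)): pE => ->.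
by rewrite mE !rmorphD /= rmorphN /= -pmulrn; ring.
Qed.

Theorem theorem3p10 (E : abmod) (lam : rat) (ls : seq rat) (delta : rat) :
  is_theme E -> primitive E lam -> fund_inv E ls ->
  delta > nth 0 ls (rk E).-1 + (rk E)%:R - 1 ->
  [/\ is_theme (dual_tensor E (ratr delta)),
      primitive (dual_tensor E (ratr delta)) (delta - lam)
    & fund_inv (dual_tensor E (ratr delta)) (rev (map (fun l => delta - l) ls))].
Proof.
move=> tE pE fE dl; have [P [Q [M [fr gM]]]] := theme_has_form tE fE.
have mulam := invariants_congruent (frame_coords fr) gM pE.
have [P' [Q' fr']] := frame_dual delta fr.
have H := frame_coords fr'; have gD := theme_form_dual delta gM.
have sz : size ls = rk E by case: fE.
split.
(* The first exponent of the dual is delta - lambda_k, and the hypothesis on delta says exactly that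
   it exceeds k - 1. *)
- apply: (theme_form_is_theme H gD) => k0; rewrite /= subn0; lra.
- apply: (theme_form_primitive H gD) => i ik.
  have [|m ->] := mulam ((rk E).-1 - i)%N; first by move: ik => /=; lia.
  by exists (- m); rewrite rmorphN /=; ring.
apply: (theme_form_fund_inv H erefl _ _); last by rewrite size_rev size_map sz.
case: gD => gl gd g0 gr.
have lsE i : (i < rk E)%N ->
    nth 0 (rev [seq delta - l | l <- ls]) i = delta - nth 0 ls ((rk E).-1 - i)%N.
  move=> ik; rewrite nth_rev size_map sz // (nth_map 0) ?sz; last by lia.
  by congr (delta - nth 0 ls _); lia.
split=> // i ik; first by rewrite lsE // gd.
by rewrite !lsE ?(ltnW ik) //; apply: gr.
Qed.
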